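(* Let $E$ be a real Banach lattice with order continuous norm. Let $T:E\to E$ be a positive, irreducible and power bounded operator. If there exists $m\in\mathbb{N}$ such that $T^m \geq K>0$ for a compact operator or a kernel operator $K:E\to E$, then $\sigma_p(T_{\mathbb{C}}^n) \cap \Gamma \subseteq \{1\}$ for some $n\in\mathbb{N}$, where $\Gamma=\{z\in\mathbb{C}:|z|=1\}$.
   Context: Let $E$ be a real Banach lattice with order continuous norm and $\mathbb{N}=\{1,2,\dots\}$. For operators, $S\ge K$ means $S-K$ is positive, and $K>0$ means $K$ is positive and $K\neq 0$. An operator $T$ on $E$ is power bounded if $\sup_{n\ge 0}\|T^n\|<\infty$. It is irreducible if the only closed (lattice) ideals $J\subseteq E$ with $TJ\subseteq J$ are $\{0\}$ and $E$. A linear operator on $E$ is regular if it is the difference of two positive operators; the regular operators on $E$ form an order complete vector lattice. $E'\otimes E$ denotes the space of finite rank operators on $E$. Kernel operators are the elements of $(E'\otimes E)^{\perp\perp}$, the band generated by $E'\otimes E$ in the lattice of regular operators. $E_{\mathbb{C}}$ denotes the complexification of $E$ and $T_{\mathbb{C}}:E_{\mathbb{C}}\to E_{\mathbb{C}}$ the complexification of $T$. $\sigma_p$ denotes the point spectrum (set of eigenvalues). *)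

(* Defs.v *)
From HB Require Import structures.
From mathcomp Require Import all_boot all_order all_algebra.
From mathcomp Require Import complex.
From mathcomp Require Import all_classical all_reals all_analysis.
Set Implicit Arguments.
Unset Strict Implicit.
Unset Printing Implicit Defensive.
Import Order.TTheory GRing.Theory Num.Theory.
Import numFieldNormedType.Exports.
Local Open Scope classical_set_scope.
Local Open Scope ring_scope.
Local Open Scope complex_scope.

(* The order is carried by the mixin instead of being inherited from
   Order.POrder: Hierarchy-Builder rejects a structure that combines an order
   with a normed module, since Num.NumDomain would have to be above it.
   The infimum of x and y is - bl_join (- x) (- y). *)
HB.mixin Record isBanachLattice (R : realType) E
    of CompleteNormedModule R E := {
  bl_le : E -> E -> Prop ;
  bl_join : E -> E -> E ;
  bl_le_refl : forall x, bl_le x x ;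
  bl_le_anti : forall x y, bl_le x y -> bl_le y x -> x = y ;
  bl_le_trans : forall y x z, bl_le x y -> bl_le y z -> bl_le x z ;
  bl_leUx : forall x y z, bl_le (bl_join x y) z <-> bl_le x z /\ bl_le y z ;
  bl_leD2r : forall z x y, bl_le x y -> bl_le (x + z) (y + z) ;
  bl_scale_ge0 : forall (a : R) x, 0 <= a -> bl_le 0 x -> bl_le 0 (a *: x) ;
  bl_norm_mono : forall x y,
    bl_le (bl_join x (- x)) (bl_join y (- y)) -> `|x| <= `|y|
}.

#[short(type="banachLatticeType")]
HB.structure Definition BanachLattice (R : realType) :=
  { E of CompleteNormedModule R E & isBanachLattice R E }.

Local Notation "x <=E y" := (bl_le x y) (at level 70, y at next level).

Section banach_lattice.
Context {R : realType} {E : banachLatticeType R}.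

Definition lat_abs (x : E) : E := bl_join x (- x).

Definition order_continuous_norm : Prop :=
  forall A : set E, A !=set0 ->
    (forall x y, A x -> A y -> exists2 z, A z & z <=E x /\ z <=E y) ->
    (forall x, A x -> 0 <=E x) ->
    (forall l, (forall x, A x -> l <=E x) -> l <=E 0) ->
    inf [set `|x| | x in A] = 0.

Definition lat_ideal (J : set E) : Prop :=
  [/\ J 0,
      forall (a : R) x y, J x -> J y -> J (a *: x + y) &
      forall x y, J y -> lat_abs x <=E lat_abs y -> J x].

(* Operators are plain functions E -> E, so that they can be added, subtracted
   and compared with =; linearity is carried by {linear E -> E} or by the
   predicates below. *)

Definition positive_op (S : E -> E) : Prop := forall x, 0 <=E x -> 0 <=E S x.

Definition op_ge (S K : E -> E) : Prop := positive_op (S \- K).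

Definition opnorm (S : E -> E) : \bar R :=
  ereal_sup [set `|S x|%:E | x in [set x | `|x| <= 1]].

Definition power_bounded (S : E -> E) : Prop :=
  (ereal_sup [set opnorm (iter n S) | n in [set: nat]] < +oo)%E.

Definition irreducible_op (S : E -> E) : Prop :=
  forall J : set E, closed J -> lat_ideal J -> S @` J `<=` J ->
    J = [set 0] \/ J = [set: E].

Definition compact_op (S : E -> E) : Prop :=
  precompact (S @` [set x | `|x| <= 1]).

Definition regular_op (S : E -> E) : Prop :=
  exists A B : {linear E -> E},
    [/\ positive_op A, positive_op B & S = A \- B].

(* A is the modulus of S, i.e. the supremum of S and - S, in the ordered vector
   space of regular operators *)
Definition is_modulus (S A : E -> E) : Prop :=
  [/\ regular_op A, op_ge A S, op_ge A (\- S) &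
      forall B, regular_op B -> op_ge B S -> op_ge B (\- S) -> op_ge B A].

(* |S| /\ |U| = 0 among regular operators; the moduli of regular operators exist
   and are unique as soon as E is order complete *)
Definition op_disjoint (S U : E -> E) : Prop :=
  exists A B, [/\ is_modulus S A, is_modulus U B, positive_op A, positive_op B &
    forall C, regular_op C -> op_ge A C -> op_ge B C -> op_ge (cst 0) C].

Definition op_perp (D : set (E -> E)) : set (E -> E) :=
  [set S | regular_op S /\ forall U, D U -> op_disjoint S U].

(* the tensor product E' (x) E; a linear form is in E' when it is continuous *)
Definition finite_rank_ops : set (E -> E) :=
  [set S | exists (n : nat) (phi : 'I_n -> {linear E -> R^o}) (y : 'I_n -> E),
    (forall i, continuous (phi i)) /\
    S = (fun x => \sum_(i < n) (phi i x : R) *: y i)].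

Definition kernel_op (S : E -> E) : Prop := op_perp (op_perp finite_rank_ops) S.

End banach_lattice.
Arguments order_continuous_norm {R} E.

(* The pair (x, y) stands for x + i y. Only the complex vector space structure
   is set up: the point spectrum does not depend on the norm. *)
Definition complexification {R : realType} (E : lmodType R) : Type := (E * E)%type.

Section complexification.
Context {R : realType} {E : lmodType R}.
Local Notation EC := (complexification E).

HB.instance Definition _ := GRing.Zmodule.on EC.

Definition cplx_scale (c : R[i]) (z : EC) : EC :=
  (complex.Re c *: z.1 - complex.Im c *: z.2,
   complex.Re c *: z.2 + complex.Im c *: z.1).

Let cplx_scaleA a b z :
  cplx_scale a (cplx_scale b z) = cplx_scale (a * b) z.
Proof.
case: a b z => [a1 a2] [b1 b2] [x y]; rewrite /cplx_scale /=; congr pair.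
- rewrite !scalerBr !scalerDr !scalerA !scalerBl !scalerDl !opprD -!addrA.
  by congr (_ + _); rewrite addrA addrC.
- rewrite !scalerBr !scalerDr !scalerA !scalerBl !scalerDl -!addrA.
  by congr (_ + _); rewrite addrA addrC.
Qed.

Let cplx_scale1 : left_id 1 cplx_scale.
Proof. by case=> x y; rewrite /cplx_scale /= !scale1r !scale0r subr0 addr0. Qed.

Let cplx_scaleDr : right_distributive cplx_scale +%R.
Proof.
move=> [a b] [x y] [z t]; rewrite /cplx_scale /=; congr pair => /=.
- by rewrite !scalerDr opprD addrACA.
- by rewrite !scalerDr addrACA.
Qed.

Let cplx_scaleDl z : {morph cplx_scale^~ z : a b / a + b}.
Proof.
case: z => x y [a1 a2] [b1 b2]; rewrite /cplx_scale /=; congr pair => /=.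
- by rewrite !scalerDl opprD addrACA.
- by rewrite !scalerDl addrACA.
Qed.

HB.instance Definition _ := GRing.Zmodule_isLmodule.Build R[i] EC
  cplx_scaleA cplx_scale1 cplx_scaleDr cplx_scaleDl.

Definition complexify_op (S : E -> E) (z : EC) : EC := (S z.1, S z.2).

Lemma complexify_op_is_linear (S : {linear E -> E}) : linear (complexify_op S).
Proof.
move=> c [x1 x2] [y1 y2]; rewrite /complexify_op /=.
by congr pair; rewrite /= !linearD ?linearN !linearZ.
Qed.

HB.instance Definition _ (S : {linear E -> E}) :=
  GRing.isLinear.Build R[i] EC EC *:%R (complexify_op S)
    (complexify_op_is_linear S).

End complexification.

Definition point_spectrum (K : pzRingType) (V : lmodType K) (S : V -> V) : set K :=
  [set l | exists2 v, v != 0 & S v = l *: v].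

(* Main.v *)
Require Import Defs.
From HB Require Import structures.
From mathcomp Require Import all_boot all_order all_algebra.
From mathcomp Require Import complex.
From mathcomp Require Import all_classical all_reals all_analysis.
From mathcomp Require Import ring lra.
Import Order.TTheory GRing.Theory Num.Theory.
Import numFieldNormedType.Exports.
Local Open Scope classical_set_scope.
Local Open Scope ring_scope.
Local Open Scope complex_scope.
Set Implicit Arguments.
Unset Strict Implicit.
Unset Printing Implicit Defensive.

(** Let x + i y be an eigenvector of some power T^n for an eigenvalue mu with
    |mu| = 1. Since mu acts as a rotation, the orbit of v := |x| + |y| under T is
    order bounded, and the orbit of 2 (v + T v + ... + T^(n-1) v) stays above v.
    Applying the Hahn-Banach theorem to the upper limit of the norms of the
    positive parts of Cesaro means therefore yields a nonzero positive functional
    f fixed by T; irreducibility makes f strictly positive. As the norm is order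
    continuous, the orbit of v has a supremum, which turns out to be a fixed
    vector e of T, and by irreducibility again no nonzero vector is disjoint from
    e. Both f and e are fixed once and for all (fixed_vector_and_functional).

    Given any unimodular eigenvector z of a power of T, some powers T^(k_i)
    converge to the identity on the real and the imaginary part of z. Let M be the
    set of all vectors v with T^(k_i) v -> v. Since f |T^n v| decreases with n and
    recurs, it is constant, so T |v| = |T v| by strict positivity: M is a closed
    sublattice on which T is a lattice homomorphism
    (recurrent_homomorphic_sublattice). An operator K with 0 <= K <= T^m then maps
    disjoint positive vectors of M to disjoint vectors.

    This last property bounds the granularity of M from below: there is eps > 0,
    the same for all eigenvectors z, such that e is not a sum of pairwise disjoint elements of
    M of norm less than eps. For compact K, signs on such small pieces could be
    chosen so that finitely many given functionals are almost zero at the image of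
    the signed sum, although this image has modulus K e (not_fine_compact). A
    kernel operator dominates a nonzero positive operator L with
    L x <= |x| w, norm of x times a fixed vector (kernel_op_minorant), and then
    L e, being the supremum of the images of the pieces, would be at most eps w
    (not_fine_dominated).

    Consequently M contains an atom p, namely a minimal component of e without a
    fine decomposition, and the norm of p is at least eps. Order continuity turns
    this into a lower bound for f p (strictly_positive_absolute_continuity). The
    vectors T^i p are atoms of the same mass f p below e, so p returns to itself
    after at most N steps, where N is the same for all eigenvectors. Put n := N!,
    so that T^n p = p. If now T^n z = mu z with mu <> 1, then the sums of the
    T^(n j) z are bounded; but every vector of M has constant sign on the atom p,
    so these sums would grow linearly on p unless z vanishes there. As the sum of
    the T^i p is a nonzero fixed vector, z would vanish altogether
    (bounded_sums_eq0). *)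

(** * Deciding linear identities in a module *)

Inductive lin_expr (R : Type) : Type :=
| LinVar of nat
| LinZero
| LinAdd of lin_expr R & lin_expr R
| LinOpp of lin_expr R
| LinScale of R & lin_expr R.
Arguments LinVar {R}.
Arguments LinZero {R}.

Section lin_expr.
Context {R : pzRingType} {V : lmodType R}.
Implicit Types (s t : lin_expr R) (env : seq V).

Fixpoint lin_eval env t : V :=
  match t with
  | LinVar i => env`_i
  | LinZero => 0
  | LinAdd s t => lin_eval env s + lin_eval env t
  | LinOpp t => - lin_eval env t
  | LinScale c t => c *: lin_eval env t
  end.

Fixpoint lin_coef t (i : nat) : R :=
  match t with
  | LinVar j => if Nat.eqb i j then 1 else 0
  | LinZero => 0
  | LinAdd s t => lin_coef s i + lin_coef t i
  | LinOpp t => - lin_coef t i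
  | LinScale c t => c * lin_coef t i
  end.

Fixpoint lin_agree s t (n : nat) : Prop :=
  if n is n'.+1 then lin_coef s n' = lin_coef t n' /\ lin_agree s t n' else True.

Lemma lin_evalE env t :
  lin_eval env t = \sum_(i < size env) lin_coef t i *: env`_i.
Proof.
elim: t => /= [j||s -> t ->|t ->|c t ->].
- have [ltj|gej] := ltnP j (size env).
    rewrite (bigD1 (Ordinal ltj)) //= PeanoNat.Nat.eqb_refl scale1r big1 ?addr0//.
    move=> i /eqP ij; have -> : Nat.eqb i j = false.
      by apply/PeanoNat.Nat.eqb_neq => e; apply: ij; exact: val_inj.
    by rewrite scale0r.
  rewrite nth_default// big1// => i _; have -> : Nat.eqb i j = false.
    by apply/PeanoNat.Nat.eqb_neq => e; move: (ltn_ord i); rewrite e ltnNge gej.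
  by rewrite scale0r.
- by rewrite big1// => i _; rewrite scale0r.
- by rewrite -big_split /=; apply: eq_bigr => i _; rewrite scalerDl.
- by rewrite -sumrN; apply: eq_bigr => i _; rewrite scaleNr.
- by rewrite scaler_sumr; apply: eq_bigr => i _; rewrite scalerA.
Qed.

(** Comparing coefficients variable by variable reduces an identity between
    linear expressions over V to finitely many identities between scalars. *)
Lemma lin_eval_eq env s t :
  lin_agree s t (size env) -> lin_eval env s = lin_eval env t.
Proof.
rewrite !lin_evalE => st; apply: eq_bigr => i _; congr (_ *: _).
elim: (size env) st (nat_of_ord i) (ltn_ord i) => [//|n IH] /= [e /IH{}IH] j.
by rewrite ltnS leq_eqVlt => /predU1P[->//|/IH].
Qed.

End lin_expr.

(* Atoms are compared up to conversion: rewriting may produce the same operation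
   along different inheritance paths. *)
Ltac lin_index x l :=
  match l with
  | ?y :: _ => let _ := match goal with _ => unify x y end in constr:(O)
  | _ :: ?l' => let n := lin_index x l' in constr:(S n)
  end.
Ltac lin_insert x l :=
  match goal with
  | _ => let _ := lin_index x l in l
  | _ => constr:(x :: l)
  end.
Ltac lin_vars t l :=
  lazymatch t with
  | 0 => l
  | ?a + ?b => let l' := lin_vars a l in lin_vars b l'
  | - ?a => lin_vars a l
  | ?c *: ?a => lin_vars a l
  | ?a *+ _ => lin_vars a l
  | _ => lin_insert t l
  end.
Ltac lin_quote R t l :=
  lazymatch t with
  | 0 => constr:(@LinZero R)
  | ?a + ?b => let a' := lin_quote R a l in let b' := lin_quote R b l in
               constr:(@LinAdd R a' b')
  | - ?a => let a' := lin_quote R a l in constr:(@LinOpp R a')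
  | ?c *: ?a => let a' := lin_quote R a l in constr:(@LinScale R c a')
  | _ => let i := lin_index t l in constr:(@LinVar R i)
  end.
(** The scalars are those of the realType found in the context. *)
Ltac linear_identity :=
  rewrite ?mulr2n;
  lazymatch goal with R : realType |- @eq ?V ?s ?t =>
    let l0 := constr:(@nil V) in
    let l1 := lin_vars s l0 in let l := lin_vars t l1 in
    let s' := lin_quote R s l in let t' := lin_quote R t l in
    refine (@lin_eval_eq _ _ l s' t' _); cbn -[GRing.add GRing.mul GRing.opp
      GRing.inv GRing.one GRing.zero GRing.natmul]; repeat split;
    first [lra | ring | field]
  end.

(** * Vector lattice calculus *)

Notation "x <=E y" := (bl_le x y) (at level 70, y at next level).
Notation "x :\/: y" := (bl_join x y) (at level 40, left associativity).

Definition bl_meet {R : realType} {E : banachLatticeType R} (x y : E) : E :=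
  - (- x :\/: - y).
Notation "x :/\: y" := (bl_meet x y) (at level 40, left associativity).

Definition pos_part {R : realType} {E : banachLatticeType R} (x : E) : E :=
  x :\/: 0.

Definition lat_disjoint {R : realType} {E : banachLatticeType R} (x y : E) : Prop :=
  x :/\: y = 0.

Section linear_order.
Context {R : realType} {E : banachLatticeType R}.
Implicit Types (x y z u v : E).

Lemma bl_lexx x : x <=E x. Proof. exact: bl_le_refl. Qed.

Lemma bl_trans y x z : x <=E y -> y <=E z -> x <=E z.
Proof. exact: bl_le_trans. Qed.

Lemma bl_anti x y : x <=E y -> y <=E x -> x = y.
Proof. exact: bl_le_anti. Qed.

Lemma bl_scale0 (r : R) x : 0 <= r -> 0 <=E x -> 0 <=E r *: x.
Proof. exact: bl_scale_ge0. Qed.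

Lemma le_bl_add x y u v : x <=E y -> u <=E v -> x + u <=E y + v.
Proof.
move=> xy uv; apply: (@bl_trans (y + u)); first exact: bl_leD2r.
by rewrite ![y + _]addrC; exact: bl_leD2r.
Qed.

(** Linear reasoning about the order goes through this lemma: the hypotheses are
    added up to a single inequality, and only a linear identity remains. *)
Lemma le_bl_sub x y u v : u <=E v -> y - x = v - u -> x <=E y.
Proof.
move=> uv e; have -> : x = u + (x - u) by linear_identity.
have -> : y = v + (x - u) by rewrite -(subrK x y) e; linear_identity.
exact: bl_leD2r.
Qed.

End linear_order.

Tactic Notation "by_le" uconstr(h) := refine (le_bl_sub h _); linear_identity.

Section vector_lattice.
Context {R : realType} {E : banachLatticeType R}.
Implicit Types (x y z a b c u v w d : E) (r t : R).

Lemma bl_subr_ge0 x y : (0 <=E y - x) <-> (x <=E y).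
Proof. by split=> h; by_le h. Qed.

Lemma le_blZ r x y : 0 <= r -> x <=E y -> r *: x <=E r *: y.
Proof. by move=> r0 /bl_subr_ge0/(bl_scale0 r0) h; by_le h. Qed.

Lemma bl_add_ge0 x y : 0 <=E x -> 0 <=E y -> 0 <=E x + y.
Proof. by move=> x0 y0; rewrite -(addr0 0); exact: le_bl_add. Qed.

Lemma le_join_l x y : x <=E x :\/: y.
Proof. by have [/(_ (bl_lexx _))[]] := bl_leUx x y (x :\/: y). Qed.

Lemma le_join_r x y : y <=E x :\/: y.
Proof. by have [/(_ (bl_lexx _))[]] := bl_leUx x y (x :\/: y). Qed.

Lemma join_le x y z : x <=E z -> y <=E z -> x :\/: y <=E z.
Proof. by move=> xz yz; apply/bl_leUx. Qed.

Lemma bl_joinC x y : x :\/: y = y :\/: x.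
Proof.
by apply: bl_anti; apply: join_le; solve [exact: le_join_l|exact: le_join_r].
Qed.

Lemma joinDr x y z : (x :\/: y) + z = (x + z) :\/: (y + z).
Proof.
apply: bl_anti.
  have h : x :\/: y <=E (x + z) :\/: (y + z) - z.
    apply: join_le.
      by have h := le_join_l (x + z) (y + z); by_le h.
    by have h := le_join_r (x + z) (y + z); by_le h.
  by by_le h.
apply: join_le.
  by have h := le_join_l x y; by_le h.
by have h := le_join_r x y; by_le h.
Qed.

Lemma joinZ r x y : 0 <= r -> r *: (x :\/: y) = (r *: x) :\/: (r *: y).
Proof.
rewrite le_eqVlt => /predU1P[<-|r0].
  rewrite !scale0r; apply: bl_anti; first exact: le_join_l.
  by apply: join_le; exact: bl_lexx.
apply: bl_anti.
  have h : x :\/: y <=E r^-1 *: ((r *: x) :\/: (r *: y)).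
    have ri : 0 <= r^-1 by rewrite invr_ge0 ltW.
    apply: join_le.
      by have h := le_blZ ri (le_join_l (r *: x) (r *: y)); rewrite scalerK ?gt_eqF in h.
    by have h := le_blZ ri (le_join_r (r *: x) (r *: y)); rewrite scalerK ?gt_eqF in h.
  by have := le_blZ (ltW r0) h; rewrite scalerKV ?gt_eqF.
by apply: join_le; apply: le_blZ (ltW r0) _; [exact: le_join_l|exact: le_join_r].
Qed.

Lemma meetE x y : x :/\: y = x - pos_part (x - y).
Proof.
rewrite /bl_meet /pos_part (bl_joinC (- x)).
have -> : (x - y) :\/: 0 = (- y :\/: - x) + x.
  by rewrite joinDr addNr addrC bl_joinC.
by linear_identity.
Qed.

Lemma joinE x y : x :\/: y = y + pos_part (x - y).
Proof. by rewrite addrC /pos_part joinDr subrK add0r. Qed.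

Lemma bl_meetC x y : x :/\: y = y :/\: x.
Proof. by rewrite /bl_meet bl_joinC. Qed.

Lemma meet_le_l x y : x :/\: y <=E x.
Proof. by have h := le_join_l (- x) (- y); rewrite /bl_meet; by_le h. Qed.

Lemma meet_le_r x y : x :/\: y <=E y.
Proof. by rewrite bl_meetC; exact: meet_le_l. Qed.

Lemma le_meet x y z : z <=E x -> z <=E y -> z <=E x :/\: y.
Proof.
move=> zx zy; have h : - x :\/: - y <=E - z.
  by apply: join_le; [by_le zx|by_le zy].
by rewrite /bl_meet; by_le h.
Qed.

Lemma le_meet2 x y u v : x <=E u -> y <=E v -> x :/\: y <=E u :/\: v.
Proof.
move=> xu yv; apply: le_meet.
  by apply: bl_trans xu; exact: meet_le_l.
by apply: bl_trans yv; exact: meet_le_r.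
Qed.

Lemma meetDr x y z : (x :/\: y) + z = (x + z) :/\: (y + z).
Proof.
rewrite /bl_meet !opprD -joinDr; linear_identity.
Qed.

Lemma meetZ r x y : 0 <= r -> r *: (x :/\: y) = (r *: x) :/\: (r *: y).
Proof. by move=> r0; rewrite /bl_meet scalerN joinZ// !scalerN. Qed.

Lemma meet_idl x y : x <=E y -> x :/\: y = x.
Proof.
move=> xy; apply: bl_anti; first exact: meet_le_l.
by apply: le_meet => //; exact: bl_lexx.
Qed.

Lemma bl_meetACA x y u v : (x :/\: y) :/\: (u :/\: v) = (x :/\: u) :/\: (y :/\: v).
Proof.
have aux a b c d : (a :/\: b) :/\: (c :/\: d) <=E (a :/\: c) :/\: (b :/\: d).
  by apply: le_meet; apply: le_meet2; solve [exact: meet_le_l|exact: meet_le_r].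
by apply: bl_anti.
Qed.

(** ** Positive parts and moduli *)

Lemma pos_ge0 x : 0 <=E pos_part x.
Proof. exact: le_join_r. Qed.

Lemma le_pos x : x <=E pos_part x.
Proof. exact: le_join_l. Qed.

Lemma pos_le x y : 0 <=E y -> x <=E y -> pos_part x <=E y.
Proof. by move=> y0 xy; apply: join_le. Qed.

Lemma pos_mono x y : x <=E y -> pos_part x <=E pos_part y.
Proof.
by move=> xy; apply: pos_le; [exact: pos_ge0|apply: bl_trans xy (le_pos _)].
Qed.

Lemma pos_id x : 0 <=E x -> pos_part x = x.
Proof.
move=> x0; apply: bl_anti; last exact: le_pos.
by apply: pos_le => //; exact: bl_lexx.
Qed.

Lemma pos_eq0 x : x <=E 0 -> pos_part x = 0.
Proof.
move=> x0; apply: bl_anti; last exact: pos_ge0.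
by apply: pos_le => //; exact: bl_lexx.
Qed.

Lemma posD x y : pos_part (x + y) <=E pos_part x + pos_part y.
Proof.
apply: pos_le; first by apply: bl_add_ge0; exact: pos_ge0.
by apply: le_bl_add; exact: le_pos.
Qed.

Lemma posZ r x : 0 <= r -> pos_part (r *: x) = r *: pos_part x.
Proof. by move=> r0; rewrite /pos_part joinZ// scaler0. Qed.

Lemma posN_add x : pos_part x = pos_part (- x) + x.
Proof. by rewrite /pos_part joinDr addNr add0r bl_joinC. Qed.

Lemma pos_subN x : x = pos_part x - pos_part (- x).
Proof. by rewrite posN_add; linear_identity. Qed.

Lemma absE x : lat_abs x = pos_part x + pos_part (- x).
Proof.
rewrite posN_add.
have -> : lat_abs x = 2 *: pos_part (- x) + x.
  rewrite -posZ// /pos_part joinDr /lat_abs bl_joinC.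
  by congr (_ :\/: _); linear_identity.
by linear_identity.
Qed.

Lemma abs_ge0 x : 0 <=E lat_abs x.
Proof. by rewrite absE; apply: bl_add_ge0; exact: pos_ge0. Qed.

Lemma le_abs x : x <=E lat_abs x.
Proof. exact: le_join_l. Qed.

Lemma leN_abs x : - x <=E lat_abs x.
Proof. exact: le_join_r. Qed.

Lemma abs_le x y : x <=E y -> - x <=E y -> lat_abs x <=E y.
Proof. exact: join_le. Qed.

Lemma abs_id x : 0 <=E x -> lat_abs x = x.
Proof.
by move=> x0; rewrite absE (pos_id x0) pos_eq0 ?addr0//; by_le x0.
Qed.

Lemma absN x : lat_abs (- x) = lat_abs x.
Proof. by rewrite /lat_abs opprK bl_joinC. Qed.

Lemma absZ r x : lat_abs (r *: x) = `|r| *: lat_abs x.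
Proof.
wlog r0 : r / 0 <= r => [h|].
  have [r0|/ltW r0] := leP 0 r; first exact: h.
  by rewrite -[r in LHS]opprK scaleNr absN h ?oppr_ge0// normrN.
by rewrite ger0_norm// /lat_abs joinZ// scalerN.
Qed.

Lemma absD x y : lat_abs (x + y) <=E lat_abs x + lat_abs y.
Proof.
apply: abs_le; first by apply: le_bl_add; exact: le_abs.
by rewrite opprD; apply: le_bl_add; exact: leN_abs.
Qed.

Lemma absB x y : lat_abs (x - y) = lat_abs (y - x).
Proof. by rewrite -absN opprB. Qed.

Lemma dist_abs x y : lat_abs (lat_abs x - lat_abs y) <=E lat_abs (x - y).
Proof.
have aux a b : lat_abs a - lat_abs b <=E lat_abs (a - b).
  by have h := absD (a - b) b; rewrite subrK in h; by_le h.
by apply: abs_le; rewrite ?opprB//; rewrite absB.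
Qed.

Lemma pos_le_abs x : pos_part x <=E lat_abs x.
Proof. by apply: pos_le; [exact: abs_ge0|exact: le_abs]. Qed.

Lemma pos_halfE x : pos_part x = 2^-1 *: (x + lat_abs x).
Proof. by rewrite absE (posN_add x); linear_identity. Qed.

Lemma abs_eq0 x : lat_abs x = 0 -> x = 0.
Proof.
move=> x0; apply: bl_anti; first by rewrite -x0; exact: le_abs.
by have h := leN_abs x; rewrite x0 in h; by_le h.
Qed.

(** ** The lattice norm *)

Lemma norm_abs x : `|lat_abs x| = `|x|.
Proof.
have aa : lat_abs (lat_abs x) = lat_abs x by rewrite abs_id//; exact: abs_ge0.
apply/le_anti/andP; split; apply: bl_norm_mono;
  by rewrite -!/(lat_abs _) aa; exact: bl_lexx.
Qed.

Lemma abs_norm_le x y : lat_abs x <=E y -> `|x| <= `|y|.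
Proof.
move=> xy; apply: bl_norm_mono; apply: bl_trans xy _; exact: le_abs.
Qed.

Lemma ge0_norm_le x y : 0 <=E x -> x <=E y -> `|x| <= `|y|.
Proof. by move=> x0 xy; apply: abs_norm_le; rewrite abs_id. Qed.

Lemma norm_pos x : `|pos_part x| <= `|x|.
Proof.
rewrite -[leRHS]norm_abs; apply: ge0_norm_le; [exact: pos_ge0|exact: pos_le_abs].
Qed.

Lemma norm_pos_le x y : x <=E y -> `|pos_part x| <= `|y|.
Proof.
move=> xy; apply: le_trans (norm_pos y); apply: ge0_norm_le; first exact: pos_ge0.
exact: pos_mono.
Qed.

(** The positive cone is closed, in the form in which limits are taken below. *)
Lemma le0_approx x :
  (forall eps : R, 0 < eps -> exists2 d, x <=E d & `|d| < eps) -> x <=E 0.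
Proof.
move=> h; have : `|pos_part x| <= 0.
  apply/ler_addgt0Pr => eps /h[d xd dlt]; rewrite add0r.
  by apply: le_trans (ltW dlt); exact: norm_pos_le.
by rewrite normr_le0 => /eqP <-; exact: le_pos.
Qed.

Lemma archimedean_le0 x b : (forall n : nat, n%:R *: x <=E b) -> x <=E 0.
Proof.
move=> h; apply: le0_approx => eps eps0.
have [n nb] : exists n : nat, `|b| / eps < n.+1%:R.
  exists (Num.bound (`|b| / eps)).
  apply: lt_trans (archi_boundP (divr_ge0 (normr_ge0 b) (ltW eps0))) _.
  by rewrite ltr_nat.
have r0 k : 0 <= k.+1%:R^-1 :> R by rewrite invr_ge0.
exists (n.+1%:R^-1 *: b).
  have := le_blZ (r0 n) (h n.+1).
  by rewrite scalerA mulVf// scale1r.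
rewrite normrZ ger0_norm ?invr_ge0// mulrC ltr_pdivrMr// -ltr_pdivrMl//.
by rewrite mulrC.
Qed.

(** ** Disjointness *)

Lemma disjoint_sym a b : lat_disjoint a b -> lat_disjoint b a.
Proof. by rewrite /lat_disjoint bl_meetC. Qed.

Lemma disjoint_le a b x y : lat_disjoint a b -> 0 <=E x -> x <=E a ->
  0 <=E y -> y <=E b -> lat_disjoint x y.
Proof.
move=> ab x0 xa y0 yb; apply: bl_anti; last exact: le_meet.
by rewrite -ab; exact: le_meet2.
Qed.

Lemma disjointD a b c : 0 <=E a -> 0 <=E b -> 0 <=E c ->
  lat_disjoint a b -> lat_disjoint a c -> lat_disjoint a (b + c).
Proof.
move=> a0 b0 c0 ab ac; apply: bl_anti; last first.
  by apply: le_meet => //; exact: bl_add_ge0.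
rewrite -[X in _ <=E X]ab; apply: le_meet; first exact: meet_le_l.
have h : a :/\: (b + c) - b <=E a :/\: c.
  apply: le_meet.
    by have h := le_bl_add (meet_le_l a (b + c)) b0; by_le h.
  by have h := meet_le_r a (b + c); by_le h.
by rewrite ac in h; by_le h.
Qed.

Lemma disjointZ r a b : 0 <= r -> 0 <=E a -> 0 <=E b ->
  lat_disjoint a b -> lat_disjoint a (r *: b).
Proof.
move=> r0 a0 b0 ab; pose s := Num.max r 1.
have s0 : 0 <= s by rewrite le_max r0.
apply: (@disjoint_le (s *: a) (s *: b)) => //.
- by rewrite /lat_disjoint -meetZ// ab scaler0.
- rewrite -bl_subr_ge0 -[X in _ - X]scale1r -scalerBl.
  by apply: bl_scale0; rewrite ?subr_ge0 ?le_max ?lexx ?orbT.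
- exact: bl_scale0.
- rewrite -bl_subr_ge0 -scalerBl.
  by apply: bl_scale0; rewrite ?subr_ge0 ?le_max ?lexx.
Qed.

Lemma disjoint_posN x : lat_disjoint (pos_part x) (pos_part (- x)).
Proof. by rewrite /lat_disjoint meetE -pos_subN subrr. Qed.

Lemma disjoint_join a b : lat_disjoint a b -> a :\/: b = a + b.
Proof.
rewrite /lat_disjoint meetE joinE => ab.
have -> : pos_part (a - b) = a by apply/esym/eqP; rewrite -subr_eq0 ab.
by rewrite addrC.
Qed.

Lemma disjoint_abs_sub a b : lat_disjoint a b -> 0 <=E a -> 0 <=E b ->
  lat_abs (a - b) = a + b.
Proof.
move=> ab a0 b0; rewrite absE opprB.
have := ab; rewrite /lat_disjoint meetE => /subr0_eq <-.
by have := disjoint_sym ab; rewrite /lat_disjoint meetE => /subr0_eq <-.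
Qed.

Lemma disjoint_absD x y : lat_disjoint (lat_abs x) (lat_abs y) ->
  lat_abs (x + y) = lat_abs x + lat_abs y.
Proof.
move=> xy; apply: bl_anti; first exact: absD.
rewrite -(disjoint_abs_sub xy); try exact: abs_ge0.
by rewrite -[y]opprK absN; exact: dist_abs.
Qed.

Lemma riesz_split x y z : 0 <=E x -> 0 <=E y -> 0 <=E z -> z <=E x + y ->
  exists u v, [/\ 0 <=E u, u <=E x, 0 <=E v, v <=E y & z = u + v].
Proof.
move=> x0 y0 z0 zxy; exists (z :/\: x), (pos_part (z - x)); split.
- exact: le_meet.
- exact: meet_le_r.
- exact: pos_ge0.
- by apply: pos_le => //; by_le zxy.
- by rewrite meetE subrK.
Qed.

End vector_lattice.
(** * The Hahn-Banach theorem *)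

Section hahn_banach.
Context {R : realType} {V : lmodType R}.
Implicit Types (p q : V -> R) (x y : V).

Definition sublinear p : Prop :=
  (forall x y, p (x + y) <= p x + p y) /\
  (forall r x, 0 <= r -> p (r *: x) = r * p x).

Lemma sublinear0 p : sublinear p -> p 0 = 0.
Proof. by case=> _ /(_ 0 0 (lexx _)); rewrite scale0r mul0r. Qed.

(** A common construction of sublinear functions: each value is an infimum, and
    the competitors can be added and rescaled. *)
Lemma sublinear_inf (S : V -> set R) :
  (forall x, S x !=set0) -> (forall x, has_lbound (S x)) ->
  (forall x y s t, S x s -> S y t -> exists2 u, S (x + y) u & u <= s + t) ->
  (forall r x s, 0 < r -> S x s -> exists2 u, S (r *: x) u & u <= r * s) ->
  (forall s, S 0 s -> 0 <= s) -> S 0 0 ->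
  sublinear (fun x => inf (S x)).
Proof.
move=> S0 lbS SD SZ S0_ge0 S00.
have infP x : has_inf (S x) by split.
have SZle r x : 0 < r -> inf (S (r *: x)) <= r * inf (S x).
  move=> r0; rewrite -ler_pdivrMl//; apply: lb_le_inf => // s Ss.
  have [u Su us] := SZ _ _ _ r0 Ss; rewrite ler_pdivrMl//.
  by apply: le_trans us; exact: ge_inf.
split=> [x y|r x].
  rewrite -lerBlDr; apply: lb_le_inf => // s Ss.
  rewrite lerBlDr -lerBlDl; apply: lb_le_inf => // t St; rewrite lerBlDl.
  have [u Su ust] := SD _ _ _ _ Ss St.
  by apply: le_trans ust; exact: ge_inf.
rewrite le_eqVlt => /predU1P[<-|r0].
  rewrite scale0r mul0r; apply/le_anti/andP; split; first exact: ge_inf.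
  exact: lb_le_inf.
apply/le_anti/andP; split; first exact: SZle.
have ri : 0 < r^-1 by rewrite invr_gt0.
have := SZle r^-1 (r *: x) ri; rewrite scalerK ?gt_eqF// => h.
by rewrite -ler_pdivlMl.
Qed.

Lemma sublinear_lower q x y : sublinear q -> - q (- x) <= q (x + y) - q y.
Proof.
case=> qD _; rewrite lerBrDr addrC -lerBrDr opprK.
by have := qD (x + y) (- x); rewrite addrAC subrr add0r.
Qed.

(** Sliding x along the ray of direction y lowers a sublinear function as much
    as is needed to make it linear on that line. *)
Lemma sublinear_slide q y : sublinear q ->
  exists q', [/\ sublinear q', forall x, q' x <= q x &
                 forall x, q' x <= q (x + y) - q y].
Proof.
move=> sq; have [qD qZ] := sq.
pose S x := [set q (x + t *: y) - t * q y | t in [set t : R | 0 <= t]].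
have lbS x : has_lbound (S x).
  exists (- q (- x)) => _ [t /= t0 <-].
  by rewrite -qZ//; exact: sublinear_lower.
exists (fun x => inf (S x)); split.
- apply: sublinear_inf => //.
  + by move=> x; exists (q (x + 0 *: y) - 0 * q y); exists 0 => //=.
  + move=> x1 x2 _ _ [s /= s0 <-] [t /= t0 <-].
    exists (q (x1 + x2 + (s + t) *: y) - (s + t) * q y).
      by exists (s + t) => //=; exact: addr_ge0.
    rewrite mulrDl opprD addrACA lerD2r scalerDl addrACA.
    exact: qD.
  + move=> r x _ r0 [t /= t0 <-].
    exists (q (r *: x + (r * t) *: y) - r * t * q y).
      by exists (r * t) => //=; rewrite mulr_ge0// ltW.
    by rewrite -scalerA -scalerDr (qZ _ _ (ltW r0)) [leRHS]mulrBr mulrA.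
  + by move=> _ [t /= t0 <-]; rewrite ?add0r qZ// subrr.
  + by exists 0 => //=; rewrite scale0r addr0 mul0r subr0 sublinear0.
- move=> x; apply: ge_inf => //; exists 0 => //=.
  by rewrite scale0r addr0 mul0r subr0.
- by move=> x; apply: ge_inf => //; exists 1 => //=; rewrite scale1r mul1r.
Qed.

(** A minimal sublinear function is linear, since sliding cannot lower it; the
    minimal functions below p are provided by Zorn's lemma. *)
Lemma linear_minorant p : sublinear p -> exists f : {scalar V}, forall x, f x <= p x.
Proof.
move=> sp; pose T := {q : V -> R | sublinear q /\ forall x, q x <= p x}.
pose rel_T (q q' : T) := `[< forall x, sval q' x <= sval q x >].
have [|||A totA|[q [sq qp]] minq] := @Zorn T rel_T.
- by move=> q; apply/asboolP.
- move=> q1 q2 q3 /asboolP h /asboolP h'; apply/asboolP => x.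
  exact: le_trans (h' x) (h x).
- move=> [q1 h1] [q2 h2] /asboolP h /asboolP h'; apply: eq_exist => /=.
  by apply/funext => x; apply/le_anti; rewrite h h'.
- have [[q0 Aq0]|A0] := pselect (A !=set0); last first.
    exists (exist _ p (conj sp (fun x => lexx _))) => s As.
    by exfalso; apply: A0; exists s.
  pose S x := [set sval q x | q in A].
  have lbS x : has_lbound (S x).
    exists (- p (- x)) => _ [[q [sq qp]] _ <-] /=.
    have := sublinear_lower x 0 sq; rewrite addr0 (sublinear0 sq) subr0.
    by apply: le_trans; rewrite lerN2.
  have sS : sublinear (fun x => inf (S x)).
    apply: sublinear_inf => //.
    + by move=> x; exists (sval q0 x); exists q0.
    + move=> x y _ _ [q1 A1 <-] [q2 A2 <-].
      have [/asboolP h|/asboolP h] := totA _ _ A1 A2.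
        exists (sval q2 (x + y)); first by exists q2.
        by apply: le_trans (proj1 (proj1 (svalP q2)) x y) _; rewrite lerD2r.
      exists (sval q1 (x + y)); first by exists q1.
      by apply: le_trans (proj1 (proj1 (svalP q1)) x y) _; rewrite lerD2l.
    + move=> r x _ r0 [q Aq <-]; exists (sval q (r *: x)); first by exists q.
      by rewrite (proj2 (proj1 (svalP q)) _ _ (ltW r0)).
    + by move=> _ [q _ <-]; rewrite (sublinear0 (proj1 (svalP q))).
    + by exists q0 => //; rewrite (sublinear0 (proj1 (svalP q0))).
  have Sp x : inf (S x) <= p x.
    apply: le_trans (proj2 (svalP q0) x).
    by apply: ge_inf => //; exists q0.
  exists (exist _ (fun x => inf (S x)) (conj sS Sp)) => q Aq.
  by apply/asboolP => x /=; apply: ge_inf => //; exists q.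
have superD x y : q x + q y <= q (x + y).
  have [q' [sq' q'q h]] := sublinear_slide y sq.
  have q'p z : q' z <= p z by exact: le_trans (qp z).
  have := minq (exist _ q' (conj sq' q'p)).
  move=> /(_ _)/(congr1 sval) /= e; rewrite -lerBrDr -{1}e //.
  exact/asboolP.
have qD x y : q (x + y) = q x + q y.
  by apply/le_anti; rewrite superD (proj1 sq).
have qN x : q (- x) = - q x.
  by apply/eqP; rewrite -subr_eq0 opprK addrC -qD subrr (sublinear0 sq).
have ql : linear_for *%R q.
  move=> r x y; rewrite qD; congr (_ + _).
  have [r0|/ltW r0] := leP 0 r; first by rewrite (proj2 sq).
  by rewrite -[r in LHS]opprK scaleNr qN (proj2 sq) ?oppr_ge0// mulNr opprK.
pose f : {scalar V} := HB.pack q (GRing.isLinear.Build R V R *%R q ql).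
by exists f.
Qed.

Theorem hahn_banach p y : sublinear p ->
  exists2 f : {scalar V}, (forall x, f x <= p x) & f y = p y.
Proof.
move=> sp; have [q [sq qp h]] := sublinear_slide y sp.
have [f fq] := linear_minorant sq; have fp x := le_trans (fq x) (qp x).
exists f => //; apply/le_anti; rewrite fp -lerN2 -linearN /=.
by apply: le_trans (fq _) _; rewrite (le_trans (h _))// addNr sublinear0// sub0r.
Qed.

End hahn_banach.
(** * Order continuity of the norm and order completeness *)

Lemma inv_succ_small {R : realType} (eps : R) : 0 < eps ->
  exists N : nat, forall n : nat, (N <= n)%N -> n.+1%:R^-1 < eps.
Proof.
move=> eps0; exists (Num.bound eps^-1) => n Nn.
rewrite -[eps]invrK ltf_pV2 ?posrE ?invr_gt0//.
apply: lt_trans (archi_boundP (ltW _)) _; first by rewrite invr_gt0.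
by rewrite ltr_nat ltnS.
Qed.

Lemma cauchy_limit {R : realType} (V : completeNormedModType R) (u : nat -> V) :
  (forall eps : R, 0 < eps -> exists N : nat, forall i j : nat,
    (N <= i)%N -> (N <= j)%N -> `|u i - u j| < eps) ->
  exists l, forall eps : R, 0 < eps -> exists N : nat, forall n : nat,
    (N <= n)%N -> `|u n - l| < eps.
Proof.
move=> uC; have : cvg (u @ \oo).
  apply: cauchy_cvg; apply: cauchy_exP => eps /uC[N hN].
  exists (u N); exists N => // n /= Nn; rewrite -ball_normE /ball_ /=.
  exact: hN.
move=> /cvg_ex[l ul]; exists l => eps eps0.
move/cvgrPdist_lt/(_ _ eps0) : ul => [N _ hN].
by exists N => n Nn; rewrite distrC; exact: hN.
Qed.

Section order_completeness.
Context {R : realType} {E : banachLatticeType R}.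
Context (ocn : order_continuous_norm E).
Implicit Types (A : set E) (x y z l b g : E) (eps : R).

Lemma order_continuous_small A : A !=set0 ->
  (forall x y, A x -> A y -> exists2 z, A z & z <=E x /\ z <=E y) ->
  (forall x, A x -> 0 <=E x) ->
  (forall l, (forall x, A x -> l <=E x) -> l <=E 0) ->
  forall eps, 0 < eps -> exists2 x, A x & `|x| < eps.
Proof.
move=> A0 Adir Apos Ainf eps eps0; have inf0 := ocn A0 Adir Apos Ainf.
have hinf : has_inf [set `|x| | x in A].
  split; first by case: A0 => x Ax; exists `|x|; exists x.
  by exists 0 => _ [x _ <-].
have [_ [x Ax <-]] := inf_adherent eps0 hinf.
by rewrite inf0 add0r => xlt; exists x.
Qed.

(** The differences between members of A and lower bounds of A form a downward
    directed set whose infimum is 0 because E is Archimedean. Hence the members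
    and the lower bounds approach each other in norm, and completeness provides
    the infimum as a norm limit. *)
Lemma inf_directed A b : A !=set0 ->
  (forall x y, A x -> A y -> exists2 z, A z & z <=E x /\ z <=E y) ->
  (forall x, A x -> b <=E x) ->
  exists2 g, (forall x, A x -> g <=E x) &
    forall eps, 0 < eps -> exists2 x, A x & `|x - g| < eps.
Proof.
move=> [a Aa] Adir bA; pose lower l := forall x, A x -> l <=E x.
pose B := [set d | exists x l, [/\ A x, lower l & d = x - l]].
have small eps : 0 < eps -> exists xl : E * E,
    [/\ A xl.1, lower xl.2 & `|xl.1 - xl.2| < eps].
  move=> eps0; suff [_ [x [l [Ax ll ->]]] dlt] : exists2 d, B d & `|d| < eps.
    by exists (x, l).
  apply: order_continuous_small eps0.
  - by exists (a - b), a, b.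
  - move=> _ _ [x [l [Ax ll ->]]] [x' [l' [Ax' ll' ->]]].
    have [z Az [zx zx']] := Adir _ _ Ax Ax'.
    exists (z - (l :\/: l')).
      by exists z, (l :\/: l'); split=> // y Ay; apply: join_le; [exact: ll|exact: ll'].
    split.
      by have h := le_bl_add zx (le_join_l l l'); by_le h.
    by have h := le_bl_add zx' (le_join_r l l'); by_le h.
  - by move=> _ [x [l [Ax ll ->]]]; apply/bl_subr_ge0; exact: ll.
  - move=> d dB; apply: (@archimedean_le0 _ _ _ (a - b)) => n.
    (* d is below x - l for all x in A and all lower bounds l, so l + d is a lower
       bound again; start from b and iterate *)
    have lown : lower (b + n%:R *: d).
      elim: n => [|n IH] x Ax; first by rewrite scale0r addr0; exact: bA.
      have h : d <=E x - (b + n%:R *: d) by apply: dB; exists x, (b + n%:R *: d).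
      by rewrite -natr1; by_le h.
    by have h := lown a Aa; by_le h.
have /choice[xl xlP] : forall n : nat, exists xl : E * E,
    [/\ A xl.1, lower xl.2 & `|xl.1 - xl.2| < n.+1%:R^-1].
  by move=> n; apply: small; rewrite invr_gt0.
have lown n := let: And3 _ h _ := xlP n in h.
have Axn n := let: And3 h _ _ := xlP n in h.
have dlt n := let: And3 _ _ h := xlP n in h.
have ldist i j : lat_abs ((xl i).2 - (xl j).2) <=E
    ((xl i).1 - (xl i).2) + ((xl j).1 - (xl j).2).
  apply: abs_le.
    have h := le_bl_add (lown i _ (Axn j)) (lown i _ (Axn i)).
    by by_le h.
  have h := le_bl_add (lown j _ (Axn i)) (lown j _ (Axn j)).
  by by_le h.
have [g gl] : exists g, forall eps, 0 < eps -> exists N : nat, forall n : nat,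
    (N <= n)%N -> `|(xl n).2 - g| < eps.
  apply: (@cauchy_limit _ E (fun n => (xl n).2)) => eps eps0.
  have [N hN] := inv_succ_small (divr_gt0 eps0 (ltr0n _ 2)).
  exists N => i j Ni Nj; apply: le_lt_trans (abs_norm_le (ldist i j)) _.
  apply: le_lt_trans (ler_normD _ _) _; rewrite (splitr eps).
  by apply: ltrD; [exact: lt_trans (dlt i) (hN _ Ni)|exact: lt_trans (dlt j) (hN _ Nj)].
exists g.
  move=> x Ax; apply/bl_subr_ge0; have h : g - x <=E 0.
    apply: le0_approx => eps /gl[N /(_ N (leqnn _))]; rewrite distrC => gN.
    by exists (g - (xl N).2) => //; have h := lown N _ Ax; by_le h.
  by by_le h.
move=> eps eps0; have e2 := divr_gt0 eps0 (ltr0n R 2).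
have [N hN] := inv_succ_small e2; have [M hM] := gl _ e2.
exists (xl (maxn M N)).1; first exact: Axn.
have -> : (xl (maxn M N)).1 - g =
  ((xl (maxn M N)).1 - (xl (maxn M N)).2) + ((xl (maxn M N)).2 - g).
  by rewrite addrA subrK.
apply: le_lt_trans (ler_normD _ _) _; rewrite (splitr eps); apply: ltrD.
  by apply: lt_trans (dlt _) _; apply: hN; exact: leq_maxr.
by apply: hM; exact: leq_maxl.
Qed.

Lemma sup_directed A b : A !=set0 ->
  (forall x y, A x -> A y -> exists2 z, A z & x <=E z /\ y <=E z) ->
  (forall x, A x -> x <=E b) ->
  exists2 g, (forall x, A x -> x <=E g) &
    forall eps, 0 < eps -> exists2 x, A x & `|g - x| < eps.
Proof.
move=> [a Aa] Adir Ab; pose B := [set - x | x in A].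
have [||_ [x Ax <-]|g gB gapp] := @inf_directed B (- b).
- by exists (- a), a.
- move=> _ _ [x Ax <-] [y Ay <-]; have [z Az [xz yz]] := Adir _ _ Ax Ay.
  by exists (- z); [exists z|split; [by_le xz|by_le yz]].
- by have h := Ab _ Ax; by_le h.
exists (- g).
  have h x : A x -> g <=E - x by move=> Ax; apply: gB; exists x.
  by move=> x /h{}h; by_le h.
move=> eps /gapp[_ [x Ax <-]] lt; exists x => //.
by rewrite -opprD normrN -normrN opprD addrC.
Qed.

Lemma lub_exists A b : A !=set0 -> (forall x, A x -> x <=E b) ->
  exists2 g, (forall x, A x -> x <=E g) &
    forall u, (forall x, A x -> x <=E u) -> g <=E u.
Proof.
move=> [a Aa] Ab; pose upper := [set u | forall x, A x -> x <=E u].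
have [|||g gU gapp] := @inf_directed upper a.
- by exists b.
- move=> u v uU vU; exists (u :/\: v); last first.
    by split; [exact: meet_le_l|exact: meet_le_r].
  by move=> x Ax; apply: le_meet; [exact: uU|exact: vU].
- by move=> u; exact.
exists g => // x Ax; apply/bl_subr_ge0.
have h : x - g <=E 0.
  apply: le0_approx => eps /gapp[u uU lt]; exists (u - g) => //.
  by have h := uU _ Ax; by_le h.
by by_le h.
Qed.

Lemma sup_increasing (u : nat -> E) b :
  (forall n, u n <=E u n.+1) -> (forall n, u n <=E b) ->
  exists2 g, (forall n, u n <=E g) &
    forall eps, 0 < eps -> exists n, `|g - u n| < eps.
Proof.
move=> uS ub; have umono m k : u m <=E u (m + k)%N.
  elim: k => [|k IH]; first by rewrite addn0; exact: bl_lexx.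
  by rewrite addnS; exact: bl_trans IH (uS _).
have [|||g gu gapp] := @sup_directed (range u) b.
- by exists (u 0%N); exists 0%N.
- move=> _ _ [m _ <-] [n _ <-]; exists (u (m + n)%N); first by exists (m + n)%N.
  by split; [exact: umono|rewrite addnC; exact: umono].
- by move=> _ [n _ <-].
exists g => [n|eps /gapp[_ [n _ <-]] lt]; last by exists n.
by apply: gu; exists n.
Qed.

(** ** Positive functionals *)

Section positive_functional.
Context (f : {scalar E}) (D : R).
Context (f_ge0 : forall x, 0 <=E x -> 0 <= f x).
Context (f_bnd : forall x, `|f x| <= D * `|x|).

Lemma functional_mono x y : x <=E y -> f x <= f y.
Proof. by move=> /bl_subr_ge0/f_ge0; rewrite linearB subr_ge0. Qed.

Lemma functional_le_approx x (c : R) :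
  (forall eps, 0 < eps -> exists2 z, f z <= c & `|x - z| < eps) -> f x <= c.
Proof.
move=> h; apply/ler_addgt0Pr => eps eps0.
have D1 : 0 < `|D| + 1 by rewrite ltr_wpDl.
have [z fz xz] := h _ (divr_gt0 eps0 D1).
rewrite -(subrK z x) linearD addrC; apply: lerD => //.
apply: le_trans (ler_norm _) _; apply: le_trans (f_bnd _) _.
apply: (@le_trans _ _ ((`|D| + 1) * `|x - z|)).
  by rewrite ler_wpM2r// ler_wpDr// ler_norm.
by rewrite mulrC -ler_pdivlMr// ltW.
Qed.

Context (f_strict : forall x, 0 <=E x -> f x = 0 -> x = 0).

(** On an order interval, smallness for a strictly positive functional forces
    smallness in norm. Otherwise there are q_j in the interval with f (q_j)
    summable and norms bounded below; the upper bounds of the tails of (q_j)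
    form a directed set with infimum 0, against the order continuity of the
    norm. *)
Lemma strictly_positive_absolute_continuity e eps : 0 <=E e -> 0 < eps ->
  exists2 del : R, 0 < del &
    forall q, 0 <=E q -> q <=E e -> f q < del -> `|q| < eps.
Proof.
move=> e0 eps0; apply: contrapT => no.
have /choice[q qP] : forall j : nat, exists q,
    [/\ 0 <=E q, q <=E e, f q < (2^-1) ^+ j & eps <= `|q|].
  move=> j; apply: contrapT => noq; apply: no.
  exists ((2^-1) ^+ j); first by rewrite exprn_gt0// invr_gt0.
  move=> q q0 qe fq; rewrite ltNge; apply/negP => qeps.
  by apply: noq; exists q.
have q0 j : 0 <=E q j by have [] := qP j.
have qe j : q j <=E e by have [] := qP j.
have fq j : f (q j) < (2^-1) ^+ j by have [] := qP j.
have qeps j : eps <= `|q j| by have [] := qP j.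
(* the join of q k, ..., q (k + n) *)
pose J k := fix J n := if n is n'.+1 then J n' :\/: q (k + n'.+1)%N else q k.
have J0 k n : 0 <=E J k n.
  case: n => [|n] /=; first exact: q0.
  by apply: bl_trans (le_join_r _ _); exact: q0.
have fJ k n : f (J k n) <= 2 * (2^-1) ^+ k - (2^-1) ^+ (k + n).
  elim: n => [|n IH] /=.
    by rewrite addn0; have := fq k; lra.
  have h : J k n :\/: q (k + n.+1)%N <=E J k n + q (k + n.+1)%N.
    apply: join_le.
      by have h := q0 (k + n.+1)%N; by_le h.
    by have h := J0 k n; by_le h.
  have := functional_mono h; rewrite linearD /=; have := fq (k + n.+1)%N.
  by rewrite addnS exprS; lra.
have /choice[y yP] : forall k, exists y, (forall j, q (k + j)%N <=E y) /\
    f y <= 2 * (2^-1) ^+ k.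
  move=> k; have [n|n|y Jy yapp] := @sup_increasing (J k) e.
  - exact: le_join_l.
  - by elim: n => [|n IH] /=; [exact: qe|exact: join_le].
  exists y; split=> [[|j]|].
  - by rewrite addn0; exact: (Jy 0%N).
  - by apply: bl_trans (Jy j.+1); exact: le_join_r.
  - apply: functional_le_approx => d /yapp[n lt]; exists (J k n) => //.
    apply: le_trans (fJ k n) _; rewrite lerBlDr lerDl exprn_ge0// invr_ge0.
pose A := [set y | exists k, forall j, (k <= j)%N -> q j <=E y].
have [|u v [k uk] [l vl]|u [k uk]|l lA|u [k uk] ulty] :=
  @order_continuous_small A _ _ _ _ eps eps0.
- by exists e, 0%N => j _; exact: qe.
- exists (u :/\: v); last by split; [exact: meet_le_l|exact: meet_le_r].
  exists (maxn k l) => j; rewrite geq_max => /andP[kj lj].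
  by apply: le_meet; [exact: uk|exact: vl].
- by apply: bl_trans (q0 k) (uk k _).
- have Ay k : A (y k).
    by exists k => j kj; have := (yP k).1 (j - k)%N; rewrite subnKC.
  suff -> : 0 = pos_part l by exact: le_pos.
  apply/esym/f_strict; first exact: pos_ge0.
  apply/le_anti/andP; split; last by apply: f_ge0; exact: pos_ge0.
  apply/ler_addgt0Pr => d d0; rewrite add0r.
  have [k hk] : exists k : nat, 2 * (2^-1) ^+ k <= d.
    have [N hN] := inv_succ_small (divr_gt0 d0 (ltr0n R 2)).
    exists N.+1; rewrite mulrC -ler_pdivlMr//.
    apply: le_trans (ltW (hN N (leqnn N))).
    rewrite exprVn lef_pV2 ?posrE ?exprn_gt0 ?ltr0n//.
    by rewrite -natrX ler_nat ltnW// ltn_expl.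
  apply: le_trans hk; apply: le_trans (yP k).2; apply: functional_mono.
  by apply: pos_le (lA _ (Ay k)); apply: bl_trans ((yP k).1 0%N); exact: q0.
- have := ge0_norm_le (q0 k) (uk k (leqnn k)).
  by move=> /(le_trans (qeps k)); rewrite leNgt ulty.
Qed.

End positive_functional.
End order_completeness.

Section norming_functional.
Context {R : realType} {E : banachLatticeType R}.

Lemma sublinear_norm_pos : sublinear (fun x : E => `|pos_part x|).
Proof.
split=> [x y|r x r0]; last by rewrite posZ// normrZ ger0_norm.
apply: le_trans (ler_normD _ _); apply: ge0_norm_le; first exact: pos_ge0.
exact: posD.
Qed.

Lemma pos_bounded_functional (f : {scalar E}) (p : E -> R) :
  (forall x, f x <= p x) -> (forall x, x <=E 0 -> p x <= 0) ->
  forall x, 0 <=E x -> 0 <= f x.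
Proof.
move=> fp p0 x x0; rewrite -oppr_le0 -linearN; apply: le_trans (fp _) _.
by apply: p0; by_le x0.
Qed.

(** A functional below the sublinear function x |-> norm of the positive part of
    x is positive and contractive. The factor 1/2 comes from keeping only the
    larger of the two parts of y. *)
Lemma norming_positive_functional (y : E) : exists f : {scalar E},
  [/\ forall x, 0 <=E x -> 0 <= f x, forall x, `|f x| <= `|x| &
      `|y| / 2 <= `|f y|].
Proof.
wlog ypos : y / `|pos_part (- y)| <= `|pos_part y| => [h|].
  have [|/ltW le] := leP `|pos_part (- y)| `|pos_part y|; first exact: h.
  have [|f [f0 fb fy]] := h (- y); first by rewrite opprK.
  by exists f; split=> //; move: fy; rewrite linearN !normrN.
have [f fp fy] := hahn_banach y sublinear_norm_pos.
exists f; split.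
- apply: (pos_bounded_functional fp) => x x0.
  by rewrite pos_eq0// normr0.
- move=> x; rewrite ler_norml; apply/andP; split.
    rewrite lerNl -linearN; apply: le_trans (fp _) _.
    by rewrite -[leRHS]normrN; exact: norm_pos.
  by apply: le_trans (fp _) _; exact: norm_pos.
- rewrite fy ger0_norm// ler_pdivrMr// {1}(pos_subN y).
  by apply: le_trans (ler_normB _ _) _; lra.
Qed.

End norming_functional.
(** * Positive parts of regular operators *)

Section riesz_kantorovich.
Context {R : realType} {E : banachLatticeType R}.
Implicit Types (x y z u v w : E) (r : R).

Lemma positive_mono (S : {linear E -> E}) x y :
  positive_op S -> x <=E y -> S x <=E S y.
Proof.
by move=> S0 /bl_subr_ge0/S0; rewrite linearB => /bl_subr_ge0.
Qed.

Lemma op_geP (S U : E -> E) : op_ge S U <-> forall x, 0 <=E x -> U x <=E S x.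
Proof. by split=> h x x0; apply/bl_subr_ge0; exact: h. Qed.

(** Every vector is a difference of positive ones, and the value of an additive
    map on such a difference does not depend on the representation. *)
Lemma kantorovich_extension (g : E -> E) :
  (forall x y, 0 <=E x -> 0 <=E y -> g (x + y) = g x + g y) ->
  (forall r x, 0 <= r -> 0 <=E x -> g (r *: x) = r *: g x) ->
  exists P : {linear E -> E}, forall x, 0 <=E x -> P x = g x.
Proof.
move=> gD gZ; pose P x := g (pos_part x) - g (pos_part (- x)).
have PE u v : 0 <=E u -> 0 <=E v -> P (u - v) = g u - g v.
  move=> u0 v0; have e : pos_part (u - v) + v = pos_part (- (u - v)) + u.
    by rewrite posN_add; linear_identity.
  have := congr1 g e; rewrite !gD//; try exact: pos_ge0.
  by move=> h; apply/eqP; rewrite subr_eq addrAC eq_sym subr_eq addrC h addrC.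
have Pl : linear P.
  have PD x y : P (x + y) = P x + P y.
    rewrite {1}(pos_subN x) {1}(pos_subN y) addrACA -opprD.
    rewrite PE ?gD//; try (by exact: pos_ge0);
      try (by apply: bl_add_ge0; exact: pos_ge0).
    by rewrite /P; linear_identity.
  have PZ r x : 0 <= r -> P (r *: x) = r *: P x.
    move=> r0; rewrite {1}(pos_subN x) scalerBr.
    rewrite PE ?gZ//; try (by exact: pos_ge0);
      try (by apply: bl_scale0 => //; exact: pos_ge0).
    by rewrite /P; linear_identity.
  have PN x : P (- x) = - P x by rewrite /P opprK opprB.
  move=> r x y; rewrite PD; congr (_ + _).
  have [r0|/ltW r0] := leP 0 r; first exact: PZ.
  by rewrite -[r in LHS]opprK scaleNr PN PZ ?oppr_ge0// scaleNr opprK.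
pose F : {linear E -> E} := HB.pack P (GRing.isLinear.Build R E E *:%R P Pl).
exists F => x x0; suff : P x = g x by [].
have g0 : g 0 = 0 by have := gZ 0 0 (lexx _) (bl_lexx 0); rewrite !scale0r.
by have := PE x 0 x0 (bl_lexx 0); rewrite subr0 g0 subr0.
Qed.

Context (ocn : order_continuous_norm E).

(** The formula of Riesz and Kantorovich for the positive part of an order
    bounded operator; additivity comes from splitting the interval [0, x + y]
    into [0, x] + [0, y]. *)
Lemma riesz_kantorovich (S : {linear E -> E}) :
  (forall x, 0 <=E x -> exists b, forall y, 0 <=E y -> y <=E x -> S y <=E b) ->
  exists P : {linear E -> E}, forall x, 0 <=E x ->
    (forall y, 0 <=E y -> y <=E x -> S y <=E P x) /\
    (forall u, (forall y, 0 <=E y -> y <=E x -> S y <=E u) -> P x <=E u).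
Proof.
move=> Sb; pose lub x g := (forall y, 0 <=E y -> y <=E x -> S y <=E g) /\
    (forall u, (forall y, 0 <=E y -> y <=E x -> S y <=E u) -> g <=E u).
have /choice[g gP] : forall x, exists g, 0 <=E x -> lub x g.
  move=> x; have [x0|nx0] := pselect (0 <=E x); last by exists 0.
  have [b hb] := Sb x x0.
  have [||g g1 g2] := @lub_exists _ _ ocn [set S y | y in [set y | 0 <=E y /\ y <=E x]] b.
  - by exists (S 0), 0 => //; split=> //; exact: bl_lexx.
  - by move=> _ [y [y0 yx] <-]; exact: hb.
  exists g => _; split.
    by move=> y y0 yx; apply: g1; exists y.
  by move=> u hu; apply: g2 => _ [y [y0 yx] <-]; exact: hu.
have gub x y : 0 <=E x -> 0 <=E y -> y <=E x -> S y <=E g x.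
  by move=> x0; exact: (gP x x0).1.
have glub x u : 0 <=E x -> (forall y, 0 <=E y -> y <=E x -> S y <=E u) -> g x <=E u.
  by move=> x0; exact: (gP x x0).2.
have gZle r x : 0 < r -> 0 <=E x -> g (r *: x) <=E r *: g x.
  move=> r0 x0; apply: (glub); first by apply: bl_scale0 => //; exact: ltW.
  move=> y y0 yx; have ri : 0 <= r^-1 by rewrite invr_ge0 ltW.
  rewrite -[y](scalerKV (lt0r_neq0 r0)) linearZ /=; apply: le_blZ (ltW r0) _.
  apply: (gub) => //; first exact: bl_scale0.
  by have := le_blZ ri yx; rewrite scalerK ?gt_eqF.
have [|r x r0 x0|P PE] := @kantorovich_extension g.
- move=> x y x0 y0; have xy0 := bl_add_ge0 x0 y0; apply: bl_anti.
    apply: (glub) => // z z0 /(riesz_split x0 y0 z0)[u [v [u0 ux v0 vy ->]]].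
    by rewrite linearD; apply: le_bl_add; exact: gub.
  have h : g x <=E g (x + y) - g y.
    apply: (glub) => // u u0 ux.
    have h : g y <=E g (x + y) - S u.
      apply: (glub) => // v v0 vy.
      have h : S (u + v) <=E g (x + y).
        by apply: (gub) => //; [exact: bl_add_ge0|exact: le_bl_add].
      by rewrite linearD in h; by_le h.
    by by_le h.
  by by_le h.
- move: r0; rewrite le_eqVlt => /predU1P[<-|r0].
    rewrite !scale0r; apply: bl_anti.
      apply: (glub); first exact: bl_lexx.
      by move=> y y0 yx; rewrite (bl_anti yx y0) linear0; exact: bl_lexx.
    by have := gub 0 0 (bl_lexx _) (bl_lexx _) (bl_lexx _); rewrite linear0.
  apply: bl_anti; first exact: gZle.
  have ri : 0 < r^-1 by rewrite invr_gt0.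
  have rx0 : 0 <=E r *: x by apply: bl_scale0 => //; exact: ltW.
  have := le_blZ (ltW r0) (gZle _ _ ri rx0).
  by rewrite scalerK ?gt_eqF// scalerKV ?gt_eqF.
- by exists P => x x0; rewrite PE//; split; [exact: (gP x x0).1|exact: (gP x x0).2].
Qed.

(** The modulus of an operator S with positive part P is 2 P - S. *)
Lemma modulus_exists (S : {linear E -> E}) (b : E -> E) :
  (forall x y, 0 <=E y -> y <=E x -> S y <=E b x) ->
  exists A : {linear E -> E}, [/\ is_modulus S A, positive_op A &
    forall x, 0 <=E x -> A x <=E 2 *: b x - S x].
Proof.
move=> Sb; have [|P PP] := @riesz_kantorovich S.
  by move=> x x0; exists (b x); exact: Sb.
have SP x : 0 <=E x -> S x <=E P x.
  by move=> x0; apply: (PP x x0).1 => //; exact: bl_lexx.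
have P0 x : 0 <=E x -> 0 <=E P x.
  by move=> x0; rewrite -[X in X <=E _](linear0 S); apply: (PP x x0).1 => //; exact: bl_lexx.
pose A : {linear E -> E} := [the {linear E -> E} of (P \+ P) \- S].
have AE x : A x = P x + P x - S x by [].
have A0 : positive_op A.
  move=> x x0; rewrite AE; have h := le_bl_add (SP x x0) (P0 x x0).
  by by_le h.
exists A; split=> //; last first.
  move=> x x0; rewrite AE.
  have h : P x <=E b x by apply: (PP x x0).2 => y y0; exact: Sb.
  by have h' := le_bl_add h h; by_le h'.
split.
- exists A, [the {linear E -> E} of \0]; split=> //.
    by move=> x _; exact: bl_lexx.
  by apply/funext => x /=; rewrite subr0.
- apply/op_geP => x x0; rewrite AE.
  have h := le_bl_add (SP x x0) (SP x x0).
  by by_le h.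
- apply/op_geP => x x0; rewrite AE /=.
  have h := le_bl_add (P0 x x0) (P0 x x0).
  by by_le h.
- move=> _ [B1 [B2 [_ _ ->]]] /op_geP DS /op_geP DNS; apply/op_geP => x x0.
  pose D : {linear E -> E} := [the {linear E -> E} of B1 \- B2].
  rewrite AE -[X in _ <=E X]/(D x).
  have h : P x <=E 2^-1 *: (D x + S x).
    apply: (PP x x0).2 => y y0 /bl_subr_ge0 xy0.
    have h1 : S y <=E D y by exact: DS.
    have h2 : - S (x - y) <=E D (x - y) by exact: DNS.
    rewrite (linearB S) (linearB D) in h2.
    have half : 0 <= 2^-1 :> R by rewrite invr_ge0.
    by have h := le_blZ half (le_bl_add h1 h2); by_le h.
  by have h' := le_bl_add h h; by_le h'.
Qed.

Lemma finite_rank_dominated (U : E -> E) : finite_rank_ops U ->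
  linear U /\ exists w, forall x, lat_abs (U x) <=E `|x| *: w.
Proof.
move=> [n [phi [y [phic ->]]]]; split.
  move=> r x z; rewrite scaler_sumr -big_split /=; apply: eq_bigr => i _.
  by rewrite linearP scalerDl scalerA.
have /choice[M MP] : forall i, exists M : R, forall x, `|phi i x : R| <= M * `|x|.
  move=> i; have /linear_boundedP/pinfty_ex_gt0[M _ hM] :=
    @continuous_linear_bounded _ _ _ 0 (phi i) (phic i 0).
  by exists M.
exists (\sum_(i < n) M i *: lat_abs (y i)) => x.
rewrite scaler_sumr; elim/big_ind2 : _ => [|u u' v v' hu hv|i _].
- by rewrite abs_id; exact: bl_lexx.
- by apply: bl_trans (absD _ _) _; exact: le_bl_add.
- rewrite absZ scalerA [_ * M i]mulrC; apply/bl_subr_ge0; rewrite -scalerBl.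
  by apply: bl_scale0; [rewrite subr_ge0|exact: abs_ge0].
Qed.

(** A positive operator in the band generated by the finite rank operators
    cannot be disjoint from all of them, for otherwise it would be disjoint from
    itself. Being not disjoint from a finite rank operator means having a
    nonzero positive operator below it and below the modulus of a finite rank
    operator, which is dominated by multiples of a single vector w. *)
Lemma kernel_op_minorant (K : {linear E -> E}) :
  positive_op K -> kernel_op K -> (exists x, K x != 0) ->
  exists (L : {linear E -> E}) w, [/\ positive_op L, op_ge K L,
    exists x, L x != 0 & forall x, 0 <=E x -> L x <=E `|x| *: w].
Proof.
move=> K0 [Kreg Kperp] [x0 Kx0]; apply: contrapT => noL.
have Kmod : is_modulus K K.
  split=> //; first by apply/op_geP => x _; exact: bl_lexx.
  apply/op_geP => x /K0 h /=; have h' := le_bl_add h h; by_le h'.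
have Kfin : op_perp finite_rank_ops K.
  split=> // U /finite_rank_dominated[Ul [w hw]].
  pose U' : {linear E -> E} := HB.pack U (GRing.isLinear.Build R E E *:%R U Ul).
  have w0 x : 0 <=E `|x| *: w.
    by apply: bl_trans (hw x); exact: abs_ge0.
  have Ub x y : 0 <=E y -> y <=E x -> U' y <=E `|x| *: w.
    move=> y0 yx; apply: bl_trans (bl_trans (le_abs _) (hw y)) _.
    have [y_gt|] := boolP (0 < `|y|); last first.
      by rewrite normr_gt0 negbK => /eqP ->; rewrite normr0 scale0r.
    have {}w0 : 0 <=E w.
      have ri : 0 <= `|y|^-1 by rewrite invr_ge0.
      by have := bl_scale0 ri (w0 y); rewrite scalerK ?gt_eqF.
    apply/bl_subr_ge0; rewrite -scalerBl; apply: bl_scale0 => //.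
    by rewrite subr_ge0; exact: ge0_norm_le.
  have [B [Bmod B0 Bb]] := modulus_exists Ub.
  exists K, B; split=> // C [C1 [C2 [C10 C20 ->]]] /op_geP CK /op_geP CB.
  (* the positive part L of C is below K and below the modulus B of U; the absence
     of a nonzero minorant of this kind forces L = 0, so C is negative *)
  pose C' : {linear E -> E} := [the {linear E -> E} of C1 \- C2].
  have [|L LP] := @riesz_kantorovich C'.
    move=> x x_ge0; exists (C1 x) => y y0 yx; have h1 := positive_mono C10 yx.
    by have h := le_bl_add h1 (C20 y y0); rewrite /=; by_le h.
  have L0 : positive_op L.
    move=> x x_ge0; rewrite -[X in X <=E _](linear0 C').
    by apply: (LP x x_ge0).1 => //; exact: bl_lexx.
  have LK : op_ge K L.
    apply/op_geP => x x_ge0; apply: (LP x x_ge0).2 => y y0 yx.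
    by apply: bl_trans (CK y y0) _; exact: positive_mono.
  have Lw x : 0 <=E x -> L x <=E `|x| *: (3 *: w).
    move=> x_ge0; have h1 : L x <=E B x.
      apply: (LP x x_ge0).2 => y y0 yx.
      by apply: bl_trans (CB y y0) _; exact: positive_mono.
    have h2 : - U x <=E `|x| *: w := bl_trans (leN_abs _) (hw x).
    have h := le_bl_add h1 (le_bl_add (Bb x x_ge0) h2).
    rewrite -[U' x]/(U x) in h; by_le h.
  apply/op_geP => x x_ge0; suff Lx0 : L x = 0.
    by rewrite /= -Lx0; apply: (LP x x_ge0).1 => //; exact: bl_lexx.
  apply: contrapT => /eqP Lx0; apply: noL; exists L, (3 *: w); split=> //.
  by exists x.
have [A [B [[_ /op_geP AK _ _] [_ /op_geP BK _ _] _ _]]] := Kperp K Kfin.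
move=> /(_ K Kreg) h; have /op_geP{}h : op_ge (cst 0) K.
  by apply: h; exact/op_geP.
have Kpos x : 0 <=E x -> K x = 0 by move=> x_ge0; apply: bl_anti; [exact: h|exact: K0].
move/eqP : Kx0; apply; rewrite (pos_subN x0) linearB !Kpos ?subrr//; exact: pos_ge0.
Qed.

End riesz_kantorovich.
(** * Power bounded positive operators *)

Section iterated_linear.
Context {R : pzRingType} {V : lmodType R}.

Lemma iter_is_linear (T : {linear V -> V}) n : linear (iter n T).
Proof.
by elim: n => [|n IH] r x y //=; rewrite IH linearP.
Qed.

HB.instance Definition _ (T : {linear V -> V}) n :=
  GRing.isLinear.Build R V V *:%R (iter n T) (iter_is_linear T n).

End iterated_linear.

Lemma power_bounded_bound {R : realType} {E : banachLatticeType R}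
    (T : {linear E -> E}) : power_bounded T ->
  exists2 C : R, 0 < C & forall n x, `|iter n T x| <= C * `|x|.
Proof.
rewrite /power_bounded; set s := ereal_sup _ => s_lt.
have s_ub n x : `|x| <= 1 -> (`|iter n T x|%:E <= s)%E.
  move=> x1; apply: le_trans (ereal_sup_ubound _); last by exists n.
  by apply: ereal_sup_ubound; exists x.
have s_ge0 : (0 <= s)%E.
  by apply: le_trans (s_ub 0%N 0 _); rewrite ?lee_fin//= ?normr0.
have s_fin : s \is a fin_num by rewrite ge0_fin_numE.
exists (fine s + 1); first by rewrite ltr_wpDl ?fine_ge0.
move=> n x; have [->|x0] := eqVneq x 0; first by rewrite linear0 !normr0 mulr0.
have nx : 0 < `|x| by rewrite normr_gt0.
have := s_ub n (`|x|^-1 *: x).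
rewrite normrZ normfV normr_id mulVf ?gt_eqF// => /(_ (lexx _)).
rewrite linearZ normrZ normfV normr_id -(fineK s_fin) lee_fin ler_pdivrMl// mulrC.
by move=> /le_trans; apply; rewrite ler_pM2r// lerDl.
Qed.

Section banach_lattice_limits.
Context {R : realType} {E : banachLatticeType R}.

Lemma dist_abs_norm (x y : E) : `|lat_abs x - lat_abs y| <= `|x - y|.
Proof. by rewrite -[leRHS]norm_abs; apply: abs_norm_le; exact: dist_abs. Qed.

Lemma closed_approx (J : set E) :
  (forall x, (forall eps : R, 0 < eps -> exists2 y, J y & `|x - y| < eps) -> J x) ->
  closed J.
Proof.
move=> h x Jx; apply: h => eps eps0.
have [y [Jy]] := Jx _ (nbhsx_ballx x eps eps0).
by rewrite -ball_normE /ball_ /= => xy; exists y.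
Qed.

End banach_lattice_limits.

Section positive_power_bounded.
Context {R : realType} {E : banachLatticeType R} (T : {linear E -> E}) (C : R).
Context (T0 : positive_op T) (C0 : 0 < C).
Context (TC : forall n x, `|iter n T x| <= C * `|x|).
Implicit Types (x y z v w : E) (eps : R).

Lemma iter_positive n : positive_op (iter n T).
Proof. by elim: n => [//|n IH] x x0; apply: T0; exact: IH. Qed.

Lemma abs_iter_le n x : lat_abs (iter n T x) <=E iter n T (lat_abs x).
Proof.
have P := @positive_mono _ _ (iter n T) _ _ (@iter_positive n).
by apply: abs_le; [|rewrite -linearN]; apply: P; [exact: le_abs|exact: leN_abs].
Qed.

Lemma abs_map_le x : lat_abs (T x) <=E T (lat_abs x).
Proof. exact: (abs_iter_le 1). Qed.

(** The functional is a linear minorant of the upper limit of the norms of the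
    positive parts of the Cesaro means, a sublinear function that vanishes on
    the range of id - T and is positive at e0 because its orbit stays above v. *)
Lemma invariant_functional (e0 v : E) : 0 <=E v -> v != 0 ->
  (forall n, v <=E iter n T e0) ->
  exists f : {scalar E}, [/\ forall x, 0 <=E x -> 0 <= f x,
    forall x, `|f x| <= C * `|x|, forall x, f (T x) = f x & 0 < f e0].
Proof.
move=> v0 vn0 ve0; pose a n x : E := n.+1%:R^-1 *: \sum_(k < n.+1) iter k T x.
have ni n : 0 <= n.+1%:R^-1 :> R by rewrite invr_ge0.
have aD n x y : a n (x + y) = a n x + a n y.
  rewrite /a -scalerDr -big_split /=; congr (_ *: _).
  by apply: eq_bigr => k _; rewrite linearD.
have aZ n r x : a n (r *: x) = r *: a n x.
  rewrite /a scalerA mulrC -scalerA; congr (_ *: _).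
  by rewrite scaler_sumr; apply: eq_bigr => k _; rewrite linearZ.
have a_norm n x : `|a n x| <= C * `|x|.
  rewrite normrZ ger0_norm// ler_pdivrMl//.
  apply: le_trans (ler_norm_sum _ _ _) _.
  apply: le_trans (_ : _ <= \sum_(k < n.+1) C * `|x|) _.
    by apply: ler_sum => k _; exact: TC.
  by rewrite sumr_const card_ord mulr_natl.
pose S x := [set t : R | 0 <= t /\ exists N : nat, forall n : nat,
  (N <= n)%N -> `|pos_part (a n x)| <= t].
have lbS x : has_lbound (S x) by exists 0 => t [].
have CS x : S x (C * `|x|).
  split; first by rewrite mulr_ge0// ltW.
  by exists 0%N => n _; exact: le_trans (norm_pos _) (a_norm _ _).
pose p x := inf (S x).
have sp : sublinear p.
  apply: sublinear_inf => //.
  - by move=> x; exists (C * `|x|); exact: CS.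
  - move=> x y s t [s0 [N hN]] [t0 [M hM]]; exists (s + t) => //.
    split; first exact: addr_ge0.
    exists (maxn N M) => n; rewrite geq_max => /andP[Nn Mn]; rewrite aD.
    apply: le_trans (sublinear_norm_pos.1 _ _) _.
    by apply: lerD; [exact: hN|exact: hM].
  - move=> r x s r0 [s0 [N hN]]; exists (r * s) => //.
    split; first by rewrite mulr_ge0// ltW.
    exists N => n Nn; rewrite aZ (sublinear_norm_pos.2 _ _ (ltW r0)).
    by rewrite ler_pM2l//; exact: hN.
  - by move=> s [].
  - split=> //; exists 0%N => n _.
    by rewrite -(scale0r (0 : E)) aZ scale0r pos_eq0 ?normr0//; exact: bl_lexx.
have [f fp fe0] := hahn_banach e0 sp.
have fC x : f x <= C * `|x|.
  by apply: le_trans (fp x) _; apply: ge_inf => //; exact: CS.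
(* the Cesaro means of x - T x telescope *)
have f_sub x : f (x - T x) <= 0.
  apply: le_trans (fp _) _; apply/ler_addgt0Pr => eps eps0; rewrite add0r.
  apply: ge_inf => //; split; first exact: ltW.
  pose b := (1 + C) * `|x| + 1.
  have b0 : 0 < b by rewrite ltr_wpDl// mulr_ge0// addr_ge0// ltW.
  have [N hN] := inv_succ_small (divr_gt0 eps0 b0).
  exists N => n Nn; apply: le_trans (norm_pos _) _.
  have -> : a n (x - T x) = n.+1%:R^-1 *: (x - iter n.+1 T x).
    rewrite /a; congr (_ *: _); elim: (n.+1) => [|m IH]; first by rewrite big_ord0 subrr.
    by rewrite big_ord_recr /= IH linearB /= -iterSr /= addrA subrK.
  rewrite normrZ ger0_norm//.
  apply: (@le_trans _ _ (n.+1%:R^-1 * b)).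
    apply: ler_wpM2l => //; apply: le_trans (ler_normB _ _) _.
    by have := TC n.+1 x; rewrite /b /=; lra.
  by rewrite -ler_pdivlMr// ltW// hN.
exists f; split.
- apply: (pos_bounded_functional fp) => x x0; apply: ge_inf => //; split=> //.
  exists 0%N => n _; rewrite pos_eq0 ?normr0//.
  have h : 0 <=E \sum_(k < n.+1) iter k T (- x).
    elim/big_ind : _ => [|u w|k _]; [exact: bl_lexx|exact: bl_add_ge0|].
    by apply: iter_positive; by_le x0.
  have e : a n x = - (n.+1%:R^-1 *: \sum_(k < n.+1) iter k T (- x)).
    by rewrite -[X in a n X]opprK -scaleN1r aZ scaleN1r.
  have h' := bl_scale0 (ni n) h; rewrite e.
  by by_le h'.
- move=> x; rewrite ler_norml fC andbT lerNl -linearN.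
  by rewrite -[X in C * X]normrN.
- move=> x; have := f_sub x; have := f_sub (- x).
  rewrite (linearN T) !(linearB f) !(linearN f) => h1 h2.
  by apply/le_anti/andP; split; lra.
- rewrite fe0; apply: lt_le_trans (_ : 0 < `|v|) _; first by rewrite normr_gt0.
  apply: lb_le_inf; first by exists (C * `|e0|); exact: CS.
  move=> t [_ [N /(_ N (leqnn _))]]; apply: le_trans; apply: ge0_norm_le => //.
  apply: bl_trans (le_pos _).
  have -> : v = N.+1%:R^-1 *: \sum_(k < N.+1) v.
    by rewrite sumr_const card_ord -[v *+ _]scaler_nat scalerA mulVf ?scale1r.
  apply: le_blZ => //; elim/big_ind2 : _ => [|u u' w w' h h'|k _].
  + exact: bl_lexx.
  + exact: le_bl_add.
  + exact: ve0.
Qed.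

Context (Tirr : irreducible_op T).

Section invariant_functional_irreducible.
Context (f : {scalar E}).
Context (f_ge0 : forall x, 0 <=E x -> 0 <= f x).
Context (f_bnd : forall x, `|f x| <= C * `|x|).
Context (f_inv : forall x, f (T x) = f x).

(** The null ideal of an invariant functional is closed and invariant. *)
Lemma invariant_functional_strict : (exists x, f x != 0) ->
  forall x, 0 <=E x -> f x = 0 -> x = 0.
Proof.
move=> [y fy]; pose J := [set x | f (lat_abs x) = 0].
have f_mono := functional_mono f_ge0.
have Jle x : f (lat_abs x) <= 0 -> J x.
  by move=> h; apply/le_anti; rewrite h f_ge0//; exact: abs_ge0.
have [|||J0|JE] := Tirr (J := J).
- apply: closed_approx => x h; apply: Jle; apply: (functional_le_approx f_bnd) => eps.
  move=> /h[z Jz xz]; exists (lat_abs z); first by rewrite Jz.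
  exact: le_lt_trans (dist_abs_norm _ _) xz.
- split.
  + by rewrite /J /= abs_id ?linear0//; exact: bl_lexx.
  + move=> a x z Jx Jz; apply: Jle; apply: le_trans (f_mono _ _ (absD _ _)) _.
    by rewrite linearD absZ linearZ /= Jx Jz mulr0 addr0.
  + by move=> x z Jz xz; apply: Jle; rewrite -Jz; exact: f_mono.
- move=> _ [x Jx <-]; apply: Jle; rewrite -Jx -(f_inv (lat_abs x)).
  by apply: f_mono; exact: abs_map_le.
- move=> x x0 fx; have : J x by rewrite /J /= abs_id.
  by rewrite J0.
- have Jy z : f (lat_abs z) = 0 by have : [set: E] z by []; rewrite -JE.
  case/eqP : fy; apply/le_anti; rewrite -{1}(Jy y) f_mono//=; last exact: le_abs.
  by rewrite -oppr_le0 -linearN -(Jy y) f_mono//; exact: leN_abs.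
Qed.

End invariant_functional_irreducible.

(** The closed ideal generated by a nonzero fixed vector is invariant, hence all
    of E. Membership is stated through truncations at multiples of v. *)
Lemma fixed_vector_quasi_interior v : 0 <=E v -> v != 0 -> T v = v ->
  forall x eps, 0 < eps -> exists2 c : R, 0 <= c &
    `|pos_part (lat_abs x - c *: v)| < eps.
Proof.
move=> v0 vn0 Tv.
pose J := [set x | forall eps, 0 < eps -> exists2 c : R, 0 <= c &
    `|pos_part (lat_abs x - c *: v)| < eps].
suff : J = [set: E] by move=> JE x; have : [set: E] x by []; rewrite -JE.
have Jle x y : J y -> lat_abs x <=E lat_abs y -> J x.
  move=> Jy xy eps /Jy[c c0 lt]; exists c => //.
  apply: le_lt_trans lt; apply: ge0_norm_le; first exact: pos_ge0.
  by apply: pos_mono; by_le xy.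
have Jv : J v.
  move=> eps eps0; exists 1 => //.
  rewrite scale1r abs_id// subrr pos_eq0 ?normr0//; exact: bl_lexx.
have [|||J0|//] := Tirr (J := J).
- apply: closed_approx => x h eps eps0.
  have [y Jy xy] := h _ (divr_gt0 eps0 (ltr0n R 2)).
  have [c c0 lt] := Jy _ (divr_gt0 eps0 (ltr0n R 2)).
  exists c => //; apply: le_lt_trans (_ : _ <=
      `|pos_part (lat_abs y - c *: v) + lat_abs (x - y)|) _.
    apply: ge0_norm_le; first exact: pos_ge0.
    apply: pos_le; first by apply: bl_add_ge0; [exact: pos_ge0|exact: abs_ge0].
    have h1 := absD (x - y) y; rewrite subrK in h1.
    have h2 := le_bl_add h1 (le_pos (lat_abs y - c *: v)).
    by by_le h2.
  apply: le_lt_trans (ler_normD _ _) _; rewrite (splitr eps) norm_abs.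
  exact: ltrD.
- split.
  + move=> eps eps0; exists 0 => //.
    by rewrite abs_id ?scale0r ?subr0 ?pos_eq0 ?normr0//; exact: bl_lexx.
  + move=> a x y Jx Jy eps eps0.
    have a1 : 0 < `|a| + 1 by rewrite ltr_wpDl.
    have e2 := divr_gt0 eps0 (ltr0n R 2).
    have [c c0 cx] := Jx _ (divr_gt0 e2 a1); have [d d0 dy] := Jy _ e2.
    exists (`|a| * c + d); first by rewrite addr_ge0// mulr_ge0.
    apply: le_lt_trans (_ : _ <= `|(`|a|) *: pos_part (lat_abs x - c *: v)
        + pos_part (lat_abs y - d *: v)|) _.
      apply: ge0_norm_le; first exact: pos_ge0.
      apply: pos_le.
        apply: bl_add_ge0; last exact: pos_ge0.
        by apply: bl_scale0 => //; exact: pos_ge0.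
      have h1 := absD (a *: x) y; rewrite absZ in h1.
      have h2 := le_blZ (normr_ge0 a) (le_pos (lat_abs x - c *: v)).
      have h3 := le_bl_add h1 (le_bl_add h2 (le_pos (lat_abs y - d *: v))).
      by by_le h3.
    apply: le_lt_trans (ler_normD _ _) _; rewrite (splitr eps); apply: ler_ltD => //.
    rewrite normrZ normr_id -[leRHS](mulfVK (lt0r_neq0 a1)) mulrC.
    by apply: ler_pM => //; [exact: ltW|rewrite lerDl].
  + exact: Jle.
- move=> _ [x Jx <-] eps eps0.
  have [c c0 lt] := Jx _ (divr_gt0 eps0 C0); exists c => //.
  apply: le_lt_trans (_ : _ <= `|T (pos_part (lat_abs x - c *: v))|) _.
    apply: ge0_norm_le; first exact: pos_ge0.
    apply: pos_le; first by apply: T0; exact: pos_ge0.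
    have h := positive_mono T0 (le_pos (lat_abs x - c *: v)).
    rewrite linearB linearZ /= Tv in h.
    have h' := le_bl_add h (abs_map_le x).
    by by_le h'.
  apply: le_lt_trans (TC 1 _) _.
  by rewrite mulrC -ltr_pdivlMr.
- by move: Jv; rewrite J0 /= => /eqP; rewrite (negPf vn0).
Qed.

Lemma disjoint_fixed_vector v x : 0 <=E v -> v != 0 -> T v = v ->
  0 <=E x -> lat_disjoint x v -> x = 0.
Proof.
move=> v0 vn0 Tv x0 xv; apply/eqP; rewrite -normr_le0.
apply/ler_addgt0Pr => eps eps0; rewrite add0r.
have [c c0 lt] := fixed_vector_quasi_interior v0 vn0 Tv x eps0.
have := disjointZ c0 x0 v0 xv; rewrite /lat_disjoint meetE -{2}(abs_id x0).
by move=> /subr0_eq ->; exact: ltW.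
Qed.

Lemma positive_dominated_eq0 v m (K : {linear E -> E}) :
  0 <=E v -> v != 0 -> T v = v -> positive_op K -> op_ge (iter m T) K ->
  K v = 0 -> forall x, K x = 0.
Proof.
move=> v0 vn0 Tv K0 /op_geP KT Kv x; apply/eqP; rewrite -normr_le0.
apply/ler_addgt0Pr => eps eps0; rewrite add0r.
have [c c0 lt] := fixed_vector_quasi_interior v0 vn0 Tv x (divr_gt0 eps0 C0).
apply: le_trans (_ : _ <= `|iter m T (pos_part (lat_abs x - c *: v))|) _.
  apply: abs_norm_le; apply: bl_trans (KT _ (pos_ge0 _)).
  have hx : lat_abs (K x) <=E K (lat_abs x).
    by apply: abs_le; [|rewrite -linearN]; apply: positive_mono => //;
      [exact: le_abs|exact: leN_abs].
  apply: bl_trans hx _.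
  have h := positive_mono K0 (le_pos (lat_abs x - c *: v)).
  by rewrite linearB linearZ /= Kv scaler0 subr0 in h.
apply: le_trans (TC _ _) _.
by rewrite mulrC -ler_pdivlMr// ltW.
Qed.

End positive_power_bounded.
(** * Sublattices on which T is a lattice homomorphism *)

(** Only preservation of moduli is required of T, but by linearity T then
    preserves joins, meets, positive parts and disjointness on M. *)
Record homomorphic_sublattice {R : realType} {E : banachLatticeType R}
    (T : E -> E) (M : set E) : Prop := HomomorphicSublattice {
  hsub_linear : forall (r : R) x y, M x -> M y -> M (r *: x + y) ;
  hsub0 : M 0 ;
  hsub_abs : forall x, M x -> M (lat_abs x) ;
  hsub_map : forall x, M x -> M (T x) ;
  hsub_closed : forall x,
    (forall eps : R, 0 < eps -> exists2 y, M y & `|x - y| < eps) -> M x ;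
  hsub_hom : forall x, M x -> lat_abs (T x) = T (lat_abs x) }.

Section recurrent_vectors.
Context {R : realType} {E : banachLatticeType R} (T : {linear E -> E}) (C : R).
Context (T0 : positive_op T) (C0 : 0 < C).
Context (TC : forall n x, `|iter n T x| <= C * `|x|).
Context (f : {scalar E}) (D : R).
Context (f_ge0 : forall x, 0 <=E x -> 0 <= f x).
Context (f_bnd : forall x, `|f x| <= D * `|x|).
Context (f_inv : forall x, f (T x) = f x).
Context (f_strict : forall x, 0 <=E x -> f x = 0 -> x = 0).
Implicit Types (x y v : E) (eps : R).

Definition recurrent (k : nat -> nat) : set E :=
  [set x | forall eps, 0 < eps -> exists N : nat, forall i : nat,
     (N <= i)%N -> `|iter (k i) T x - x| < eps].

Lemma recurrent_map k x : recurrent k x -> recurrent k (T x).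
Proof.
move=> kx eps eps0; have [N hN] := kx _ (divr_gt0 eps0 C0).
exists N => i /hN; rewrite ltr_pdivlMr// mulrC => lt.
by rewrite -iterSr /= -linearB; apply: le_lt_trans (TC 1 _) lt.
Qed.

(** The number f |T^n x| decreases with n and returns to f |x| along k, so it is
    constant. Then T |x| - |T x| is a positive vector in the kernel of f. *)
Lemma recurrent_hom k x : (forall i, (0 < k i)%N) -> recurrent k x ->
  lat_abs (T x) = T (lat_abs x).
Proof.
move=> k0 kx; have f_iter n y : f (lat_abs (iter n T y)) <= f (lat_abs y).
  elim: n => [//|n]; apply: le_trans; rewrite /= -(f_inv (lat_abs (iter n T y))).
  by apply: functional_mono => //; exact: abs_map_le.
have fx : f (lat_abs x) <= f (lat_abs (T x)).
  apply: (functional_le_approx f_bnd) => eps /kx[N /(_ N (leqnn N)) lt].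
  exists (lat_abs (iter (k N) T x)).
    by rewrite -(prednK (k0 N)) iterSr; exact: f_iter.
  by apply: le_lt_trans (dist_abs_norm _ _) _; rewrite distrC.
apply/esym/subr0_eq/f_strict; first by apply/bl_subr_ge0; exact: abs_map_le.
apply/le_anti/andP; split; last first.
  by apply: f_ge0; apply/bl_subr_ge0; exact: abs_map_le.
by rewrite linearB f_inv subr_le0.
Qed.

Lemma recurrent_homomorphic_sublattice k : (forall i, (0 < k i)%N) ->
  homomorphic_sublattice T (recurrent k).
Proof.
move=> k0; split.
- move=> r x y kx ky eps eps0; have r1 : 0 < `|r| + 1 by rewrite ltr_wpDl.
  have e2 := divr_gt0 eps0 (ltr0n R 2).
  have [N hN] := kx _ (divr_gt0 e2 r1); have [N' hN'] := ky _ e2.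
  exists (maxn N N') => i; rewrite geq_max => /andP[/hN lt /hN' lt'].
  rewrite linearP opprD addrACA -scalerBr (splitr eps).
  apply: le_lt_trans (ler_normD _ _) _; apply: ler_ltD => //.
  rewrite normrZ -[leRHS](mulfVK (lt0r_neq0 r1)) mulrC.
  by apply: ler_pM => //; [exact: ltW|rewrite lerDl].
- by move=> eps eps0; exists 0%N => i _; rewrite linear0 subrr normr0.
- move=> x kx eps /(kx _)[N hN]; exists N => i /hN; apply: le_lt_trans.
  suff -> : iter (k i) T (lat_abs x) = lat_abs (iter (k i) T x).
    exact: dist_abs_norm.
  elim: (k i) => [//|n IH] /=; rewrite IH -(@recurrent_hom k)//.
  by elim: n {IH} => [//|n IH]; exact: recurrent_map.
- exact: recurrent_map.
- move=> x h eps eps0; have C2 : 0 < C + 2 by rewrite addr_gt0.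
  have [y ky xy] := h _ (divr_gt0 eps0 C2).
  have [N hN] := ky _ (divr_gt0 eps0 C2).
  exists N => i /hN lt.
  have -> : iter (k i) T x - x = iter (k i) T (x - y) + (iter (k i) T y - y) + (y - x).
    by rewrite linearB /=; linear_identity.
  apply: le_lt_trans (ler_normD _ _) _; rewrite [`|y - x|]distrC.
  apply: le_lt_trans (lerD (ler_normD _ _) (lexx _)) _.
  have h1 := TC (k i) (x - y).
  have h2 : C * `|x - y| <= C * (eps / (C + 2)) by rewrite ler_pM2l// ltW.
  have h3 : C * (eps / (C + 2)) + eps / (C + 2) + eps / (C + 2) = eps.
    by field; rewrite gt_eqF.
  by rewrite -h3; lra.
- by move=> x; exact: recurrent_hom.
Qed.

End recurrent_vectors.

Section homomorphic_sublattice.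
Context {R : realType} {E : banachLatticeType R} (T : {linear E -> E}).
Context (M : set E) (MT : homomorphic_sublattice T M).
Implicit Types (x y v : E).

Lemma hsubD x y : M x -> M y -> M (x + y).
Proof. by move=> Mx My; rewrite -[x]scale1r; exact: (hsub_linear MT). Qed.

Lemma hsubZ (r : R) x : M x -> M (r *: x).
Proof. by move=> Mx; rewrite -[r *: x]addr0; apply: (hsub_linear MT) => //; exact: (hsub0 MT). Qed.

Lemma hsubB x y : M x -> M y -> M (x - y).
Proof. by move=> Mx My; rewrite -scaleN1r; apply: hsubD => //; exact: hsubZ. Qed.

Lemma hsubN x : M x -> M (- x).
Proof. by move=> Mx; rewrite -scaleN1r; exact: hsubZ. Qed.

Lemma hsub_pos x : M x -> M (pos_part x).
Proof.
by move=> Mx; rewrite pos_halfE; apply/hsubZ/hsubD => //; exact: (hsub_abs MT).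
Qed.

Lemma hsub_meet x y : M x -> M y -> M (x :/\: y).
Proof. by move=> Mx My; rewrite meetE; apply/hsubB/hsub_pos/hsubB. Qed.

Lemma hsub_join x y : M x -> M y -> M (x :\/: y).
Proof. by move=> Mx My; rewrite joinE; apply/hsubD/hsub_pos/hsubB. Qed.

Lemma hsub_iter n x : M x -> M (iter n T x).
Proof. by elim: n => [//|n IH] /IH; exact: (hsub_map MT). Qed.

Lemma map_pos x : M x -> T (pos_part x) = pos_part (T x).
Proof. by move=> Mx; rewrite !pos_halfE linearZ linearD /= (hsub_hom MT Mx). Qed.

Lemma iter_abs n x : M x -> iter n T (lat_abs x) = lat_abs (iter n T x).
Proof.
by move=> Mx; elim: n => [//|n IH] /=; rewrite IH (hsub_hom MT)//; exact: hsub_iter.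
Qed.

Lemma iter_pos n x : M x -> iter n T (pos_part x) = pos_part (iter n T x).
Proof.
by move=> Mx; elim: n => [//|n IH] /=; rewrite IH map_pos//; exact: hsub_iter.
Qed.

Lemma iter_meet n x y : M x -> M y ->
  iter n T (x :/\: y) = iter n T x :/\: iter n T y.
Proof.
move=> Mx My; rewrite !meetE linearB /= iter_pos ?linearB//; exact: hsubB.
Qed.

Lemma map_join x y : M x -> M y -> T (x :\/: y) = T x :\/: T y.
Proof.
move=> Mx My; rewrite !joinE linearD map_pos ?linearB//; exact: hsubB.
Qed.

Lemma iter_disjoint n x y : M x -> M y -> lat_disjoint x y ->
  lat_disjoint (iter n T x) (iter n T y).
Proof. by move=> Mx My xy; rewrite /lat_disjoint -iter_meet// xy linear0. Qed.

(** The only way in which the operator K below T^m interacts with M: the images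
    under K lie below the disjoint images under T^m. *)
Lemma dominated_disjoint m (K : {linear E -> E}) x y :
  positive_op K -> op_ge (iter m T) K -> M x -> M y ->
  0 <=E x -> 0 <=E y -> lat_disjoint x y -> lat_disjoint (K x) (K y).
Proof.
move=> K0 /op_geP KT Mx My x0 y0 xy.
by apply: disjoint_le (iter_disjoint m Mx My xy) _ _ _ _; by [apply: K0|apply: KT].
Qed.

Context (C : R) (f : {scalar E}).
Context (ocn : order_continuous_norm E) (T0 : positive_op T) (C0 : 0 < C).
Context (TC : forall n x, `|iter n T x| <= C * `|x|).
Context (f_inv : forall x, f (T x) = f x).
Context (f_strict : forall x, 0 <=E x -> f x = 0 -> x = 0).

(** The supremum e of an order bounded orbit satisfies T e <= e, since T maps the
    finite suprema of the orbit to finite suprema of the orbit. *)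
Lemma fixed_vector_above v b : M v -> (forall n, iter n T v <=E b) ->
  exists2 e, T e = e & v <=E e.
Proof.
move=> Mv vb.
pose u := fix u n := if n is n'.+1 then u n' :\/: iter n'.+1 T v else v.
have [n|n|e ue uapp] := @sup_increasing _ _ ocn u b.
- exact: le_join_l.
- by elim: n => [|n IH]; [exact: (vb 0%N)|apply: join_le => //; exact: vb].
have Mu n : M (u n).
  by elim: n => [//|n IH]; apply: hsub_join => //; exact: (@hsub_iter n.+1).
have uS n : T (u n) <=E u n.+1.
  elim: n => [|n IH]; first exact: le_join_r.
  rewrite [u n.+1]/= map_join//; last exact: (@hsub_iter n.+1).
  apply: join_le; last exact: le_join_r.
  by apply: bl_trans IH _; exact: le_join_l.
exists e; last exact: (ue 0%N).
have Te : T e <=E e.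
  suff h : T e - e <=E 0 by by_le h.
  apply: le0_approx => eps eps0; have [n lt] := uapp _ (divr_gt0 eps0 C0).
  exists (T (e - u n)); last first.
    by apply: le_lt_trans (TC 1 _) _; rewrite mulrC -ltr_pdivlMr.
  rewrite linearB; have h := bl_trans (uS n) (ue n.+1).
  by by_le h.
apply/esym/subr0_eq/f_strict; first exact/bl_subr_ge0.
by rewrite linearB f_inv subrr.
Qed.

End homomorphic_sublattice.
(** * Components and atoms *)

Section components.
Context {R : realType} {E : banachLatticeType R} (e : E).
Implicit Types (p q r x y : E).

(** Equivalent to the disjointness of q and e - q; in the form of an equation it
    passes to meets and to limits. *)
Definition component q : Prop := (q + q) :/\: e = q.

Lemma componentP q : component q <-> lat_disjoint q (e - q).
Proof.
have h : q :/\: (e - q) + q = (q + q) :/\: e by rewrite meetDr subrK.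
rewrite /component /lat_disjoint -h; split=> [/eqP|->]; last exact: add0r.
by rewrite -subr_eq0 addrK => /eqP.
Qed.

Lemma component_ge0 q : component q -> 0 <=E q.
Proof. by move=> qc; have h := meet_le_l (q + q) e; rewrite qc in h; by_le h. Qed.

Lemma component_le q : component q -> q <=E e.
Proof. by move=> qc; have := meet_le_r (q + q) e; rewrite qc. Qed.

Lemma component_top : 0 <=E e -> component e.
Proof.
move=> e0; rewrite /component bl_meetC meet_idl//; have h := e0; by_le h.
Qed.

Lemma component_meet p q : component p -> component q -> component (p :/\: q).
Proof.
move=> pc qc; rewrite /component -[e in LHS](meet_idl (bl_lexx e)).
have -> : p :/\: q + p :/\: q = (p + p) :/\: (q + q).
  have dbl (z : E) : z + z = 2 *: z by linear_identity.
  by rewrite !dbl meetZ.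
by rewrite bl_meetACA pc qc.
Qed.

Lemma component_diff p q : component p -> component q -> q <=E p ->
  component (p - q).
Proof.
move=> pc qc qp; apply/componentP.
have -> : e - (p - q) = (e - p) + q by linear_identity.
have pq0 : 0 <=E p - q by exact/bl_subr_ge0.
have ep0 : 0 <=E e - p by apply/bl_subr_ge0; exact: component_le.
have q0 := component_ge0 qc.
apply: disjointD => //.
  by apply: disjoint_le (proj1 (componentP _) pc) _ _ _ (bl_lexx _) => //; by_le q0.
apply: disjoint_le (disjoint_sym (proj1 (componentP _) qc)) _ _ _ (bl_lexx _) => //.
by have h := component_le pc; by_le h.
Qed.

Lemma component_diff_disjoint p q : component p -> component q -> q <=E p ->
  lat_disjoint q (p - q).
Proof.
move=> pc qc qp; have q0 := component_ge0 qc.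
apply: disjoint_le (proj1 (componentP _) qc) _ (bl_lexx _) _ _ => //.
  exact/bl_subr_ge0.
by have h := component_le pc; by_le h.
Qed.

Lemma meet_dist x y z : `|x :/\: z - y :/\: z| <= 2 * `|x - y|.
Proof.
rewrite !meetE !pos_halfE.
have -> : x - 2^-1 *: (x - z + lat_abs (x - z)) -
    (y - 2^-1 *: (y - z + lat_abs (y - z))) =
    2^-1 *: (x - y) - 2^-1 *: (lat_abs (x - z) - lat_abs (y - z)).
  by linear_identity.
apply: le_trans (ler_normB _ _) _; rewrite !normrZ ger0_norm ?invr_ge0//.
have := dist_abs_norm (x - z) (y - z).
have -> : x - z - (y - z) = x - y by linear_identity.
have := normr_ge0 (x - y); lra.
Qed.

Lemma component_approx x :
  (forall eps : R, 0 < eps -> exists2 q, component q & `|x - q| < eps) ->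
  component x.
Proof.
move=> h; apply/subr0_eq/eqP; rewrite -normr_le0; apply/ler_addgt0Pr => eps eps0.
rewrite add0r; have [q qc xq] := h _ (divr_gt0 eps0 (ltr0n R 5)).
have -> : (x + x) :/\: e - x = ((x + x) :/\: e - (q + q) :/\: e) + (q - x).
  by rewrite qc; linear_identity.
apply: le_trans (ler_normD _ _) _; rewrite [`|q - x|]distrC.
have := meet_dist (x + x) (q + q) e.
have -> : x + x - (q + q) = 2 *: (x - q) by linear_identity.
by rewrite normrZ ger0_norm//; lra.
Qed.

(** The part of c p /\ e that exceeds p lies below the disjoint vectors c p and
    e - p. *)
Lemma component_absorb p (c : R) : component p -> 0 <= c -> 0 <=E e ->
  (c *: p) :/\: e <=E p.
Proof.
move=> pc c0 e0; have p0 := component_ge0 pc.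
set d := (c *: p) :/\: e.
have ep0 : 0 <=E e - p by apply/bl_subr_ge0; exact: component_le.
have cp0 : 0 <=E c *: p by exact: bl_scale0.
have h : lat_disjoint (c *: p) (e - p).
  by apply/disjoint_sym/disjointZ => //; apply/disjoint_sym/componentP.
have d0 : pos_part (d - p) <=E 0.
  rewrite -h; apply: le_meet; apply: pos_le => //.
    have h1 := meet_le_l (c *: p) e; have h2 := le_bl_add h1 p0.
    by rewrite -/d in h2; by_le h2.
  by have h1 := meet_le_r (c *: p) e; rewrite -/d in h1; by_le h1.
by have h1 := bl_trans (le_pos _) d0; by_le h1.
Qed.

Context (ocn : order_continuous_norm E).

(** The component of e carried by g is the supremum of the vectors n g /\ e. *)
Lemma carrier_exists (M : set E) (T : {linear E -> E}) g :
  homomorphic_sublattice T M -> M e -> M g -> 0 <=E g -> g <=E e ->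
  exists q, [/\ M q, component q, g <=E q,
    (forall x, lat_disjoint x g -> 0 <=E x -> lat_disjoint x q) &
    (forall p, component p -> g <=E p -> q <=E p)].
Proof.
move=> MT Me Mg g0 ge; have e0 := bl_trans g0 ge.
pose u n := (n.+1%:R *: g) :/\: e.
have Mu n : M (u n) by apply: (hsub_meet MT) => //; exact: (hsubZ MT).
have u0 n : 0 <=E u n by apply: le_meet => //; exact: bl_scale0.
have [n|n|q uq qapp] := @sup_increasing _ _ ocn u e.
- apply: le_meet2 (bl_lexx _); rewrite -[n.+2%:R]natr1.
  by have h := g0; by_le h.
- exact: meet_le_r.
have q0 : 0 <=E q := bl_trans (u0 0%N) (uq 0%N).
have qe : q <=E e.
  suff h : q - e <=E 0 by by_le h.
  apply: le0_approx => eps /qapp[n lt]; exists (q - u n) => //.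
  by have h := meet_le_r (n.+1%:R *: g) e; by_le h.
exists q; split.
- by apply: (hsub_closed MT) => eps /qapp[n lt]; exists (u n).
- apply: bl_anti; last by apply: le_meet => //; by_le q0.
  suff h : (q + q) :/\: e - q <=E 0 by by_le h.
  apply: le0_approx => eps eps0; have [n lt] := qapp _ (divr_gt0 eps0 (ltr0n R 4)).
  exists ((q + q) :/\: e - (u n + u n) :/\: e); last first.
    apply: le_lt_trans (meet_dist _ _ _) _.
    have -> : q + q - (u n + u n) = 2 *: (q - u n) by linear_identity.
    by rewrite normrZ ger0_norm//; lra.
  have h1 : (u n + u n) :/\: e <=E u (n + n.+1)%N.
    apply: le_meet2 (bl_lexx _); have h := meet_le_l (n.+1%:R *: g) e.
    by rewrite -addSn natrD scalerDl; exact: le_bl_add.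
  have h := bl_trans h1 (uq _).
  by by_le h.
- by apply: bl_trans (uq 0%N); apply: le_meet => //; rewrite scale1r; exact: bl_lexx.
- move=> x xg x0; apply: bl_anti; last exact: le_meet.
  apply: le0_approx => eps eps0; have [n lt] := qapp _ (divr_gt0 eps0 (ltr0n R 2)).
  exists (q :/\: x - u n :/\: x); last first.
    by apply: le_lt_trans (meet_dist _ _ _) _; lra.
  have -> : u n :/\: x = 0.
    apply: disjoint_le (disjoint_sym (disjointZ (ler0n R n.+1) x0 g0 xg)) _ _ _ _ => //.
    - exact: meet_le_l.
    - exact: bl_lexx.
  by rewrite subr0 bl_meetC; exact: bl_lexx.
- move=> p pc gp; suff h : q - p <=E 0 by by_le h.
  apply: le0_approx => eps /qapp[n lt]; exists (q - u n) => //.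
  have h : u n <=E p.
    apply: bl_trans (component_absorb pc (ler0n R n.+1) e0).
    by apply: le_meet2 (bl_lexx _); exact: le_blZ.
  by by_le h.
Qed.

End components.

(** Decompositions into pairwise disjoint members of M of small norm, built as
    binary trees so that properties of the pieces propagate by induction. *)
Inductive fine_sum {R : realType} {E : banachLatticeType R}
    (M : set E) (eps : R) : E -> Prop :=
| fine_piece q : M q -> 0 <=E q -> `|q| < eps -> fine_sum M eps q
| fine_add q r : fine_sum M eps q -> fine_sum M eps r -> lat_disjoint q r ->
    fine_sum M eps (q + r).

Section atoms.
Context {R : realType} {E : banachLatticeType R} (T : {linear E -> E}) (C : R).
Context (ocn : order_continuous_norm E).
Context (T0 : positive_op T) (C0 : 0 < C).
Context (TC : forall n x, `|iter n T x| <= C * `|x|).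
Context (Tirr : irreducible_op T).
Context (f : {scalar E}).
Context (f_ge0 : forall x, 0 <=E x -> 0 <= f x).
Context (f_bnd : forall x, `|f x| <= C * `|x|).
Context (f_inv : forall x, f (T x) = f x).
Context (f_strict : forall x, 0 <=E x -> f x = 0 -> x = 0).
Context (e : E) (e0 : 0 <=E e) (Te : T e = e).
Context (M : set E) (MT : homomorphic_sublattice T M) (Me : M e).
Implicit Types (p q r v x : E).

Lemma fine_sum_mem eps q : fine_sum M eps q -> M q /\ 0 <=E q.
Proof.
elim=> [{}q //|{}q r _ [Mq q0] _ [Mr r0] _]; split; last exact: bl_add_ge0.
exact: (hsubD MT).
Qed.

Definition atom p : Prop := [/\ M p, component e p, p != 0 &
  forall q, M q -> component e q -> q <=E p -> q = 0 \/ q = p].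

(** A component that is minimal among those without fine decompositions is an
    atom, because a fine decomposition of each of two complementary parts gives
    one of the whole. Such a component exists by Zorn's lemma: were the infimum g
    of a chain finely decomposable, adding the small difference between a member
    of the chain and g would decompose that member. *)
Lemma atom_exists (eps : R) : 0 < eps -> ~ fine_sum M eps e ->
  exists2 p, atom p & eps <= `|p|.
Proof.
move=> eps0 efine; pose good q := [/\ M q, component e q & ~ fine_sum M eps q].
have goode : good e by split=> //; exact: component_top.
pose rel_q (a b : {q | good q}) := `[< sval b <=E sval a >].
have [|||A totA|[p [Mp pc pfine]] minp] := @Zorn {q | good q} rel_q.
- by move=> a; apply/asboolP; exact: bl_lexx.
- by move=> a b c /asboolP h /asboolP h'; apply/asboolP; exact: bl_trans h' h.
- move=> [a ha] [b hb] /asboolP h /asboolP h'; apply: eq_exist => /=.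
  exact: bl_anti.
- have [[a Aa]|A0] := pselect (A !=set0); last first.
    by exists (exist _ e goode) => s As; exfalso; apply: A0; exists s.
  have [|_ _ [x Ax <-] [y Ay <-]|_ [[x [Mx xc xf]] Ax <-]|g gA gapp] :=
    @inf_directed _ _ ocn [set sval q | q in A] 0.
  + by exists (sval a), a.
  + have [/asboolP h|/asboolP h] := totA _ _ Ax Ay.
      by exists (sval y); [exists y|split=> //; exact: bl_lexx].
    by exists (sval x); [exists x|split=> //; exact: bl_lexx].
  + exact: component_ge0 xc.
  have gapp' d : 0 < d -> exists q : {q | good q},
      [/\ A q, g <=E sval q & `|sval q - g| < d].
    by move=> /gapp[_ [q Aq <-] lt]; exists q; split=> //; apply: gA; exists q.
  have Mg : M g.
    apply: (hsub_closed MT) => d /gapp'[[q [Mq qc qf]] [_ _ lt]].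
    by exists q => //; rewrite distrC.
  have gc : component e g.
    apply: component_approx => d /gapp'[[q [Mq qc qf]] [_ _ lt]].
    by exists q => //; rewrite distrC.
  have gfine : ~ fine_sum M eps g.
    move=> gfine; have [[q [Mq qc qf]] [/= _ gq lt]] := gapp' _ eps0.
    apply: (qf); have -> : q = g + (q - g) by rewrite addrC subrK.
    apply: fine_add => //; last exact: component_diff_disjoint qc gc gq.
    apply: fine_piece => //; last exact/bl_subr_ge0.
    exact: (hsubB MT).
  exists (exist _ g (And3 Mg gc gfine)) => s As; apply/asboolP => /=.
  by apply: gA; exists s.
have p_big : eps <= `|p|.
  rewrite leNgt; apply/negP => lt; apply: (pfine); apply: fine_piece => //.
  exact: component_ge0 pc.
have minp' q : good q -> q <=E p -> q = p.
  by move=> gq qp; have := minp (exist _ q gq) (asboolT qp) => /(congr1 sval).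
exists p => //; split=> //.
  by rewrite -normr_gt0; exact: lt_le_trans p_big.
move=> q Mq qc qp; have pqc := component_diff pc qc qp.
have [qfine|] := pselect (fine_sum M eps q); last first.
  by move=> qf; right; apply: minp'.
have [pqfine|pqf] := pselect (fine_sum M eps (p - q)).
  exfalso; apply: (pfine); have -> : p = q + (p - q) by rewrite addrC subrK.
  by apply: fine_add => //; exact: component_diff_disjoint pc qc qp.
left; have q0 := component_ge0 qc.
have : p - q = p.
  apply: minp'; last by by_le q0.
  by split=> //; exact: (hsubB MT).
by move=> /eqP; rewrite subr_eq -subr_eq0 opprD addNKr oppr_eq0 => /eqP.
Qed.

(** The carrier of the part of v^+ below p is a component below p, so it is 0 or
    all of p. Hence members of M do not change sign on an atom. *)
Lemma atom_sign p v : atom p -> M v ->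
  lat_disjoint (pos_part v) p \/ lat_disjoint (pos_part (- v)) p.
Proof.
move=> [Mp pc pn0 patom] Mv; have p0 := component_ge0 pc.
have Mg : M (pos_part v :/\: p) by apply: (hsub_meet MT) => //; exact: (hsub_pos MT).
have gp : pos_part v :/\: p <=E p := meet_le_r _ _.
have g0 : 0 <=E pos_part v :/\: p by apply: le_meet => //; exact: pos_ge0.
have [q [Mq qc gq qdisj qmin]] :=
  carrier_exists ocn MT Me Mg g0 (bl_trans gp (component_le pc)).
have [q0|qp] := patom q Mq qc (qmin p pc gp).
  by left; apply: bl_anti g0; rewrite -q0.
right; rewrite -qp; apply: qdisj; last exact: pos_ge0.
apply: disjoint_le (disjoint_sym (disjoint_posN v)) (pos_ge0 _) (bl_lexx _) g0 _.
exact: meet_le_l.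
Qed.

Lemma component_iter n q : M q -> component e q -> component e (iter n T q).
Proof.
move=> Mq qc; have en : iter n T e = e by elim: n => [//|n IH] /=; rewrite IH.
by rewrite /component -{1}en -linearD -(iter_meet MT) ?qc//; exact: (hsubD MT).
Qed.

(** The images of an atom have the same mass under f, and as long as they are
    pairwise disjoint their sum stays below e. So the orbit of an atom returns to
    it within f e / f p steps. *)
Lemma atom_returns p N : atom p -> f e < N%:R * f p ->
  exists d, [/\ (0 < d)%N, (d <= N)%N & iter d T p = p].
Proof.
move=> [Mp pc pn0 patom] lt; apply: contrapT => no.
have p0 := component_ge0 pc.
have f_iter n : f (iter n T p) = f p by elim: n => [//|n IH] /=; rewrite f_inv.
have disj d : (0 < d)%N -> (d <= N)%N -> lat_disjoint p (iter d T p).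
  move=> d0 dN; have Mdp : M (iter d T p) by exact: (hsub_iter MT).
  have Tdc := component_iter d Mp pc.
  have [//|pdp] := patom _ (hsub_meet MT Mp Mdp) (component_meet pc Tdc) (meet_le_l _ _).
  exfalso; apply: no; exists d; split=> //; apply/subr0_eq/f_strict.
    by apply/bl_subr_ge0; rewrite -{1}pdp; exact: meet_le_r.
  by rewrite linearB f_iter subrr.
have sum_le k : (k <= N)%N -> \sum_(i < k) iter i T p <=E e.
  elim: k => [|k IH] kN; first by rewrite big_ord0.
  rewrite big_ord_recl /=.
  have -> : \sum_(i < k) iter (lift ord0 i) T p = T (\sum_(i < k) iter i T p).
    by rewrite linear_sum; apply: eq_bigr.
  have Tle : T (\sum_(i < k) iter i T p) <=E e.
    by rewrite -[X in _ <=E X]Te; apply: positive_mono => //; apply: IH; exact: ltnW.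
  rewrite -disjoint_join; first by apply: join_le => //; exact: component_le.
  rewrite linear_sum.
  suff [] : 0 <=E \sum_(i < k) T (iter i T p) /\
    lat_disjoint p (\sum_(i < k) T (iter i T p)) by [].
  elim/big_ind : _ => [|x y [x0 px] [y0 py]|i _].
  - split; first exact: bl_lexx.
    by apply: bl_anti; [exact: meet_le_r|apply: le_meet => //; exact: bl_lexx].
  - by split; [exact: bl_add_ge0|exact: disjointD].
  - split; first exact: (iter_positive T0 i.+1).
    by apply: (disj i.+1) => //; exact: leq_trans (ltn_ord i) (ltnW kN).
have := functional_mono f_ge0 (sum_le N (leqnn N)).
rewrite linear_sum (eq_bigr (fun=> f p)) => [|i _]; last exact: f_iter.
by rewrite sumr_const card_ord -mulr_natl leNgt lt.
Qed.

Lemma iter_mul_fix d n p : iter d T p = p -> (d %| n)%N -> iter n T p = p.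
Proof.
move=> dp /dvdnP[k ->]; elim: k => [//|k IH].
by rewrite mulSn iterD IH.
Qed.

(** Suppose that v is nonnegative on an atom p fixed by T^n, and let g be the part
    of v below p. All T^(n j) v are nonnegative on p, so the sums of the T^(n j) g
    are dominated by the moduli of the sums of the T^(n j) v, whereas their mass
    under f grows linearly unless g vanishes. *)
Lemma bounded_sums_disjoint_atom p v n B : atom p -> iter n T p = p -> M v ->
  (forall k, `|\sum_(j < k) iter (n * j) T v| <= B) ->
  lat_disjoint (lat_abs v) p.
Proof.
move=> patom np; wlog vp : v / lat_disjoint (pos_part (- v)) p => [h|] Mv Bv.
  have [vp|vp] := atom_sign patom Mv; last exact: h.
  rewrite -absN; apply: h => [||k]; rewrite ?opprK//; first exact: (hsubN MT).
  rewrite (eq_bigr (fun j : 'I_k => - iter (n * j) T v)) => [|j _].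
    by rewrite sumrN normrN; exact: Bv.
  exact: linearN.
have [Mp pc _ _] := patom; have p0 := component_ge0 pc.
pose g := pos_part v :/\: p; pose h := pos_part (- v).
have Mg : M g by apply: (hsub_meet MT) => //; exact: (hsub_pos MT).
have g0 : 0 <=E g by apply: le_meet => //; exact: pos_ge0.
have njp j : iter (n * j) T p = p by apply: iter_mul_fix np _; exact: dvdn_mulr.
have Mh : M h by apply: (hsub_pos MT) => //; exact: (hsubN MT).
have f_iter j x : f (iter j T x) = f x by elim: j => [//|j IH] /=; rewrite f_inv.
pose S k := \sum_(j < k) iter (n * j) T v.
pose G k := \sum_(j < k) iter (n * j) T g.
pose H k := \sum_(j < k) iter (n * j) T h.
have GE k : [/\ 0 <=E G k, 0 <=E H k, G k <=E S k + H k & G k <=E k%:R *: p].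
  rewrite /G /S /H; elim: k => [|k [IH1 IH2 IH3 IH4]].
    by rewrite !big_ord0 addr0 scale0r; split; exact: bl_lexx.
  rewrite !big_ord_recr /=.
  have hg : iter (n * k) T g <=E iter (n * k) T p.
    by apply: positive_mono; [exact: iter_positive|exact: meet_le_r].
  have hv : iter (n * k) T g <=E iter (n * k) T v + iter (n * k) T h.
    rewrite -linearD; apply: positive_mono; first exact: iter_positive.
    by rewrite addrC -posN_add; exact: meet_le_l.
  rewrite njp in hg; split.
  - by apply: bl_add_ge0 => //; exact: iter_positive.
  - by apply: bl_add_ge0 => //; apply: iter_positive => //; exact: pos_ge0.
  - by have h1 := le_bl_add IH3 hv; by_le h1.
  - rewrite -natr1 scalerDl scale1r; exact: le_bl_add.
have Hp k : lat_disjoint p (H k).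
  suff [] : 0 <=E H k /\ lat_disjoint p (H k) by [].
  rewrite /H; elim/big_ind : _ => [|x y [x0 px] [y0 py]|j _].
  - split; first exact: bl_lexx.
    by apply: bl_anti; [exact: meet_le_r|apply: le_meet => //; exact: bl_lexx].
  - by split; [exact: bl_add_ge0|exact: disjointD].
  - split; first by apply: iter_positive => //; exact: pos_ge0.
    rewrite -(njp j); apply: (iter_disjoint MT) => //.
    exact: disjoint_sym.
have GS k : G k <=E lat_abs (S k).
  have [G0 H0 GSH Gp] := GE k.
  have h1 : pos_part (G k - lat_abs (S k)) <=E 0.
    have <- : G k :/\: H k = 0.
      apply: disjoint_le (_ : lat_disjoint (k%:R *: p) (H k)) _ _ _ (bl_lexx _) => //.
      by apply/disjoint_sym/disjointZ => //; exact: disjoint_sym.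
    apply: le_meet; apply: pos_le => //.
      by have h2 := abs_ge0 (S k); by_le h2.
    by have h2 := le_bl_add GSH (le_abs (S k)); by_le h2.
  by have h2 := bl_trans (le_pos _) h1; by_le h2.
have fG k : k%:R * f g <= C * B.
  have -> : k%:R * f g = f (G k).
    rewrite /G linear_sum (eq_bigr (fun=> f g)) => [|j _]; last exact: f_iter.
    by rewrite sumr_const card_ord mulr_natl.
  apply: le_trans (functional_mono f_ge0 (GS k)) _.
  apply: le_trans (ler_norm _) _; apply: le_trans (f_bnd _) _.
  by rewrite ler_pM2l// norm_abs; exact: Bv.
have fg0 : f g = 0.
  apply/le_anti/andP; split; last exact: f_ge0.
  rewrite leNgt; apply/negP => fg.
  have B0 : 0 <= B by apply: le_trans (Bv 0%N).
  have CB0 : 0 <= C * B / f g := divr_ge0 (mulr_ge0 (ltW C0) B0) (ltW fg).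
  have := archi_boundP CB0; rewrite ltr_pdivrMr// => lt.
  by have := lt_le_trans lt (fG _); rewrite ltxx.
rewrite absE; apply/disjoint_sym/disjointD => //; try exact: pos_ge0.
  by apply: disjoint_sym; exact: f_strict.
exact: disjoint_sym.
Qed.

(** The sum of the T^i p for i < n is a nonzero fixed vector, from which |v| is
    disjoint: to pass from p to T^i p, apply the previous lemma to T^(n - i) v. *)
Lemma bounded_sums_eq0 p v n B : (0 < n)%N -> atom p -> iter n T p = p -> M v ->
  (forall k, `|\sum_(j < k) iter (n * j) T v| <= B) -> v = 0.
Proof.
move=> n0 patom np Mv Bv; have [Mp pc pn0 _] := patom.
have p0 := component_ge0 pc.
have vip i : (i < n)%N -> lat_disjoint (lat_abs v) (iter i T p).
  move=> i_n; have hd : lat_disjoint (lat_abs (iter (n - i) T v)) p.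
    apply: (@bounded_sums_disjoint_atom _ _ n (C * B)) => //; first exact: (hsub_iter MT).
    move=> k; have -> : \sum_(j < k) iter (n * j) T (iter (n - i) T v) =
        iter (n - i) T (\sum_(j < k) iter (n * j) T v).
      by rewrite linear_sum; apply: eq_bigr => j _; rewrite /= -!iterD addnC.
    by apply: le_trans (TC _ _) _; rewrite ler_pM2l//; exact: Bv.
  have h0 : 0 <=E lat_abs v :/\: iter i T p.
    by apply: le_meet; [exact: abs_ge0|exact: iter_positive].
  apply: (f_strict h0).
  have Miv : M (lat_abs v) by exact: (hsub_abs MT).
  have Mip : M (iter i T p) by exact: (hsub_iter MT).
  have : iter (n - i) T (lat_abs v :/\: iter i T p) = 0.
    rewrite (iter_meet MT)// (iter_abs MT _ Mv) -iterD subnK ?np//; exact: ltnW.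
  move=> /(congr1 f); rewrite linear0 => <-.
  by elim: (n - i)%N => [//|k IH] /=; rewrite f_inv.
pose F := \sum_(i < n) iter i T p.
have F0 : 0 <=E F.
  by rewrite /F; elim/big_ind : _ => [|x y|i _];
    [exact: bl_lexx|exact: bl_add_ge0|exact: iter_positive].
have pF : p <=E F.
  rewrite /F; case: n n0 {np Bv vip F F0} => [//|n] _; rewrite big_ord_recl /=.
  rewrite -[X in X <=E _]addr0; apply: le_bl_add; first exact: bl_lexx.
  by elim/big_ind : _ => [|x y|i _];
    [exact: bl_lexx|exact: bl_add_ge0|exact: (iter_positive T0 i.+1)].
have Fn0 : F != 0.
  apply/eqP => F_0; case/eqP : pn0; apply: bl_anti => //.
  by rewrite -F_0.
have TF : T F = F.
  rewrite /F; case: n n0 np {Bv vip F F0 pF Fn0} => [//|n] _ np.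
  rewrite linear_sum big_ord_recr big_ord_recl /= addrC.
  by rewrite -[T (iter n T p)]/(iter n.+1 T p) np.
have vF : lat_disjoint (lat_abs v) F.
  suff [] : 0 <=E F /\ lat_disjoint (lat_abs v) F by [].
  rewrite /F; elim/big_ind : _ => [|x y [x0 px] [y0 py]|i _].
  - split; first exact: bl_lexx.
    apply: bl_anti; first exact: meet_le_r.
    by apply: le_meet; [exact: abs_ge0|exact: bl_lexx].
  - by split; [exact: bl_add_ge0|apply: disjointD => //; exact: abs_ge0].
  - by split; [exact: iter_positive|exact: vip].
apply: abs_eq0; exact: (disjoint_fixed_vector T0 C0 TC Tirr F0 Fn0 TF (abs_ge0 v) vF).
Qed.

End atoms.
(** * Fine decompositions are incompatible with K *)

Section not_fine.
Context {R : realType} {E : banachLatticeType R} (T : {linear E -> E}) (C : R).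
Context (C0 : 0 < C) (TC : forall n x, `|iter n T x| <= C * `|x|).
Context (e : E) (e0 : 0 <=E e).
Context (m : nat) (K : {linear E -> E}).
Context (K0 : positive_op K) (KT : op_ge (iter m T) K) (Ke : K e != 0).

(** Disjoint pieces have disjoint images, so K q is the supremum of the images of
    the pieces of q; these are uniformly small relative to w. *)
Lemma not_fine_dominated w : (forall x, 0 <=E x -> K x <=E `|x| *: w) ->
  exists2 eps : R, 0 < eps &
    forall M, homomorphic_sublattice T M -> ~ fine_sum M eps e.
Proof.
move=> Kw; have nKe : 0 < `|K e| by rewrite normr_gt0.
have ne : 0 < `|e| by rewrite normr_gt0; apply: contra Ke => /eqP ->; rewrite linear0.
have w0 : 0 <=E w.
  have ri : 0 <= `|e|^-1 by rewrite invr_ge0.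
  by have := bl_scale0 ri (bl_trans (K0 e0) (Kw e e0)); rewrite scalerK ?gt_eqF.
have nw1 : 0 < `|w| + 1 by rewrite ltr_wpDl.
pose eps := `|K e| / (`|w| + 1); have eps0 : 0 < eps by exact: divr_gt0.
exists eps => // M MT efine.
have Kq q : fine_sum M eps q -> K q <=E eps *: w.
  elim=> [{}q _ q0 /ltW lt|{}q r qf IHq rf IHr qr].
    apply: bl_trans (Kw q q0) _; apply/bl_subr_ge0; rewrite -scalerBl.
    by apply: bl_scale0; rewrite ?subr_ge0.
  have [[Mq q0] [Mr r0]] := (fine_sum_mem MT qf, fine_sum_mem MT rf).
  rewrite linearD -disjoint_join; first exact: join_le.
  exact: (dominated_disjoint MT K0 KT Mq Mr q0 r0 qr).
have := ge0_norm_le (K0 e0) (Kq e efine).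
rewrite normrZ (ger0_norm (ltW eps0)) /eps -mulrA ler_pMr// leNgt => /negP; apply.
by rewrite ltr_pdivrMl// mulr1 ltrDl.
Qed.

Lemma precompact_finite_net (A : set E) (rho : R) : precompact A -> 0 < rho ->
  exists s : seq E, forall x, A x -> exists2 y, y \in s & `|x - y| < rho.
Proof.
rewrite precompactE compact_cover => cA rho0.
have [|x _|D _ DA] := cA E [set: E] (fun y => ball y rho).
- by move=> y _; exact: ball_open.
- by exists x => //; exact: ballxx.
exists (finmap.enum_fset D) => x Ax; have [y /= yD] := DA x (subset_closure Ax).
by rewrite -ball_normE /ball_ /= distrC => xy; exists y.
Qed.

(** For every combination s of the pieces of e with signs, K s has the modulus
    K e and so has a fixed positive norm. By compactness there are finitely many
    functionals chi y one of which is bounded away from 0 at K s. On the other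
    hand, choosing the signs one after the other, the sum of the (chi y (K s))^2
    can be kept below the sum of the corresponding sums over the pieces, which
    tends to 0 with the size of the pieces. *)
Lemma not_fine_compact : compact_op K ->
  exists2 eps : R, 0 < eps &
    forall M, homomorphic_sublattice T M -> ~ fine_sum M eps e.
Proof.
move=> Kcpt; pose eta := `|K e|; have eta0 : 0 < eta by rewrite normr_gt0.
have ne : 0 < `|e| by rewrite normr_gt0; apply: contra Ke => /eqP ->; rewrite linear0.
have K_norm q : 0 <=E q -> `|K q| <= C * `|q|.
  move=> q0; apply: le_trans (TC m q); apply: ge0_norm_le; first exact: K0.
  by move/op_geP : KT; apply.
have rho0 : 0 < eta / 8 / `|e| by rewrite !divr_gt0.
have [net netP] := precompact_finite_net Kcpt rho0.
have /choice[chi chiP] := @norming_positive_functional R E.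
have chi0 y x : 0 <=E x -> 0 <= chi y x by have [h _ _] := chiP y; exact: h.
have chi_bnd y x : `|chi y x| <= `|x| by have [_ h _] := chiP y; exact: h.
have chiy y : `|y| / 2 <= `|chi y y| by have [_ _ h] := chiP y.
have seen s : `|s| <= `|e| -> `|K s| = eta ->
    exists2 y, y \in net & eta / 4 <= `|chi y (K s)|.
  move=> se Kse; have ei : 0 <= `|e|^-1 by rewrite invr_ge0.
  have [|y yn lt] := netP (K (`|e|^-1 *: s)).
    exists (`|e|^-1 *: s) => //=.
    by rewrite normrZ ger0_norm// mulrC ler_pdivrMr// mul1r.
  exists y => //; have {}lt : `|K s - `|e| *: y| < eta / 8.
    have -> : K s - `|e| *: y = `|e| *: (K (`|e|^-1 *: s) - y).
      have -> : K (`|e|^-1 *: s) = `|e|^-1 *: K s by exact: linearZ.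
      by rewrite scalerBr scalerKV ?gt_eqF.
    by rewrite normrZ normr_id mulrC -ltr_pdivlMr.
  have h1 : `|K s| <= `|K s - `|e| *: y| + `|e| * `|y|.
    rewrite -[X in _ + X * _]normr_id -normrZ.
    by apply: le_trans (ler_normD _ _); rewrite subrK.
  have h2 : `|e| * `|chi y y| <= `|K s - `|e| *: y| + `|chi y (K s)|.
    have -> : `|e| * `|chi y y| = `|chi y (`|e| *: y)|.
      by rewrite linearZ normrM normr_id.
    apply: le_trans (lerD (chi_bnd y _) (lexx _)).
    have -> : chi y (`|e| *: y) = chi y (K s) - chi y (K s - `|e| *: y).
      by rewrite -[X in chi y X = _](subKr (K s)); exact: raddfB.
    by rewrite [leRHS]addrC; exact: ler_normB.
  have h3 : `|e| * (`|y| / 2) <= `|e| * `|chi y y| by rewrite ler_pM2l.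
  rewrite Kse in h1; lra.
pose S x := \sum_(y <- net) chi y x; pose Q x := \sum_(y <- net) (chi y x) ^+ 2.
have S_le x : S x <= (size net)%:R * `|x|.
  rewrite /S; elim: (net) => [|y s IH]; first by rewrite big_nil mul0r.
  rewrite big_cons /= -natr1 mulrDl mul1r addrC; apply: lerD => //.
  exact: le_trans (ler_norm _) (chi_bnd _ _).
have QDB u v : Q (u + v) + Q (u - v) = (Q u + Q v) + (Q u + Q v).
  rewrite /Q -!big_split /=; apply: eq_bigr => y _.
  by rewrite linearB linearD /=; ring.
pose N := (size net)%:R : R; have N0 : 0 <= N by exact: ler0n.
have CN : 0 < 32 * C * (N + 1) by rewrite !mulr_gt0// ltr_wpDl.
(* makes C * eps * S (K e) at most eta^2 / 32, less than (eta / 4)^2 *)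
pose eps := eta / (32 * C * (N + 1)); have eps0 : 0 < eps by exact: divr_gt0.
exists eps => // M MT efine.
have signs q : fine_sum M eps q -> exists s, [/\ lat_abs s <=E q,
    lat_abs (K s) = K q & Q (K s) <= C * eps * S (K q)].
  elim=> [{}q Mq q0 lt|{}q r qf [s [sq Ks Qs]] rf [t [tr Kt Qt]] qr].
    exists q; split; rewrite ?abs_id//; [exact: bl_lexx|exact: K0|].
    rewrite /Q /S mulr_sumr; apply: ler_sum => y _; rewrite expr2.
    apply: ler_wpM2r; first exact/chi0/K0.
    apply: le_trans (ler_norm _) _; apply: le_trans (chi_bnd _ _) _.
    apply: le_trans (K_norm _ q0) _.
    by rewrite ler_pM2l// ltW.
  have [[Mq q0] [Mr r0]] := (fine_sum_mem MT qf, fine_sum_mem MT rf).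
  have Kqr := dominated_disjoint MT K0 KT Mq Mr q0 r0 qr.
  have SD : S (K (q + r)) = S (K q) + S (K r).
    rewrite /S -big_split /=; apply: eq_bigr => y _.
    by rewrite [K (q + r)]linearD linearD.
  have [le|/ltW le] := leP (Q (K s + K t)) (Q (K s - K t)).
    exists (s + t); split.
    - by apply: bl_trans (absD _ _) _; exact: le_bl_add.
    - by rewrite linearD disjoint_absD Ks Kt// linearD.
    - by rewrite SD [K (s + t)]linearD mulrDr; have := QDB (K s) (K t); lra.
  exists (s - t); split.
  - by apply: bl_trans (absD _ _) _; rewrite absN; exact: le_bl_add.
  - by rewrite linearB disjoint_absD absN Ks Kt// linearD.
  - by rewrite SD [K (s - t)]linearB mulrDr; have := QDB (K s) (K t); lra.
have [s [se Kse Qs]] := signs e efine.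
have Kseta : `|K s| = eta by rewrite -norm_abs Kse.
have [y yn hy] := seen s (abs_norm_le se) Kseta.
have h1 : (eta / 4) ^+ 2 <= Q (K s).
  apply: (@le_trans _ _ (chi y (K s) ^+ 2)).
    rewrite -[leRHS]real_normK ?num_real// lerXn2r// nnegrE//.
    by rewrite divr_ge0// ltW.
  rewrite /Q (big_rem y)//= lerDl; apply: sumr_ge0 => z _; exact: sqr_ge0.
have h2 : C * eps * S (K e) <= eta ^+ 2 / 32.
  have -> : eta ^+ 2 / 32 = C * eps * ((N + 1) * eta).
    rewrite /eps; have CN1 : N + 1 != 0 by rewrite gt_eqF// ltr_wpDl.
    by field; rewrite CN1 gt_eqF.
  rewrite (ler_pM2l (mulr_gt0 C0 eps0)); apply: le_trans (S_le _) _.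
  by rewrite ler_pM2r// lerDl.
have h3 : 0 < eta ^+ 2 by rewrite exprn_gt0.
have := le_trans h1 (le_trans Qs h2); rewrite expr_div_n.
have -> : (4 : R) ^+ 2 = 16 by ring.
by lra.
Qed.

End not_fine.

(** * Rotations *)

Section rotations.
Context {R : realType} (a b : R).
Context (ab1 : a ^+ 2 + b ^+ 2 = 1).

(** The real and imaginary parts of the powers of a + i b. *)
Fixpoint rotation (k : nat) : R * R :=
  if k is k'.+1 then
    (a * (rotation k').1 - b * (rotation k').2,
     b * (rotation k').1 + a * (rotation k').2)
  else (1, 0).

Lemma rotation_norm k : (rotation k).1 ^+ 2 + (rotation k).2 ^+ 2 = 1.
Proof.
elim: k => [|k IH] /=; first by ring.
move: (rotation k) IH => [c s] /= IH.
have -> : (a * c - b * s) ^+ 2 + (b * c + a * s) ^+ 2 =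
  (a ^+ 2 + b ^+ 2) * (c ^+ 2 + s ^+ 2) by ring.
by rewrite ab1 IH mulr1.
Qed.

Lemma rotation_bound k : `|(rotation k).1| <= 1 /\ `|(rotation k).2| <= 1.
Proof.
have h := rotation_norm k; have h1 := sqr_ge0 (rotation k).1.
have h2 := sqr_ge0 (rotation k).2.
by split; rewrite -(@expr_le1 _ 2)// real_normK ?num_real//; lra.
Qed.

Lemma rotationD j d :
  rotation (j + d) =
    ((rotation j).1 * (rotation d).1 - (rotation j).2 * (rotation d).2,
     (rotation j).2 * (rotation d).1 + (rotation j).1 * (rotation d).2).
Proof.
elim: j => [|j IH]; first by rewrite [rotation d]surjective_pairing /=; congr pair; ring.
by rewrite addSn /= IH /=; congr pair; ring.
Qed.

(** Pigeonhole principle for a grid of mesh less than eps on [-1, 1]^2. *)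
Lemma bounded_pair_recurrence (u v : nat -> R) (eps : R) :
  (forall k, `|u k| <= 1) -> (forall k, `|v k| <= 1) -> 0 < eps ->
  exists i j : nat, [/\ (i < j)%N, `|u i - u j| < eps & `|v i - v j| < eps].
Proof.
move=> u1 v1 eps0; have [B0 hB] := inv_succ_small eps0.
have {hB} := hB B0 (leqnn _); set B := B0.+1 => Beps.
have B_gt0 : 0 < B%:R :> R by rewrite ltr0n.
pose g (w : nat -> R) k := Num.Def.truncn ((w k + 1) * B%:R).
have g_ge0 (w : nat -> R) : (forall k, `|w k| <= 1) -> forall k, 0 <= (w k + 1) * B%:R.
  move=> w1 k; apply: mulr_ge0 (ltW B_gt0).
  by have := w1 k; rewrite ler_norml; lra.
have g_lt (w : nat -> R) : (forall k, `|w k| <= 1) -> forall k, (g w k < (2 * B).+1)%N.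
  move=> w1 k; rewrite truncn_lt_nat ?g_ge0// -natr1 natrM.
  have h : (w k + 1) * B%:R <= 2%:R * B%:R.
    by rewrite ler_pM2r//; have := w1 k; rewrite ler_norml; lra.
  by apply: le_lt_trans h _; rewrite ltrDl.
have g_eq (w : nat -> R) : (forall k, `|w k| <= 1) -> forall i j, g w i = g w j ->
    `|w i - w j| < eps.
  move=> w1 i j gij; apply: lt_trans Beps.
  have /andP[h1 h2] := truncn_itv (g_ge0 w w1 i).
  have /andP[h3 h4] := truncn_itv (g_ge0 w w1 j).
  rewrite -/(g w i) -/(g w j) gij in h1 h2 h3 h4; rewrite -natr1 in h2 h4.
  rewrite -[_^-1]mul1r ltr_pdivlMr// -[X in _ * X](gtr0_norm B_gt0) -normrM.
  by rewrite ltr_norml mulrBl; lra.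
pose n := #|{: 'I_(2 * B).+1 * 'I_(2 * B).+1}|.
pose G (k : 'I_n.+1) := (inord (g u k) : 'I_(2 * B).+1, inord (g v k) : 'I_(2 * B).+1).
have /injectivePn[i [j ij Gij]] : ~~ injectiveb G.
  apply/negP => /injectiveP/leq_card; rewrite card_ord -/n.
  by rewrite ltnn.
wlog lt_ij : i j ij Gij / (i < j)%N => [h|].
  have [lt|gt|/val_inj eq_ij] := ltngtP (i : nat) j.
  - exact: h lt.
  - by apply: h gt => //; rewrite eq_sym.
  - by rewrite eq_ij eqxx in ij.
exists i, j; move: Gij => [/(congr1 val) + /(congr1 val)].
rewrite /= !inordK ?g_lt// => gu gv; split=> //; exact: g_eq.
Qed.

Lemma rotation_recurrence (eps : R) : 0 < eps ->
  exists k : nat, [/\ (0 < k)%N, `|(rotation k).1 - 1| < eps & `|(rotation k).2| < eps].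
Proof.
move=> eps0; have [|||i [j [ij hc hs]]] := @bounded_pair_recurrence
  (fun k => (rotation k).1) (fun k => (rotation k).2) (eps / 2).
- by move=> k; have [] := rotation_bound k.
- by move=> k; have [] := rotation_bound k.
- exact: divr_gt0.
exists (j - i)%N; rewrite subn_gt0; have := rotationD i (j - i).
rewrite subnKC ?(ltnW ij)//; have [ci si] := rotation_bound i.
move: hc hs ci si (rotation_norm i).
move: (rotation i) (rotation j) (rotation (j - i)).
move=> [c s] [c' s'] [cd sd] /= hc hs ci si cs [ec es].
(* multiply the j-th power by the conjugate of the i-th *)
have Ec : cd - 1 = (c' - c) * c + (s' - s) * s.
  by rewrite -[cd]mulr1 -cs ec es; ring.
have Es : sd = (s' - s) * c - (c' - c) * s.
  by rewrite -[LHS]mulr1 -cs ec es; ring.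
rewrite distrC in hc; rewrite distrC in hs.
have small x y : `|x| < eps / 2 -> `|y| <= 1 -> `|x * y| < eps / 2.
  move=> hx hy; apply: le_lt_trans hx; rewrite normrM -[leRHS]mulr1.
  by apply: ler_wpM2l.
split=> //.
  rewrite Ec; apply: le_lt_trans (ler_normD _ _) _.
  by rewrite (splitr eps); apply: ltrD; exact: small.
rewrite Es; apply: le_lt_trans (ler_normB _ _) _.
by rewrite (splitr eps); apply: ltrD; exact: small.
Qed.

(** For z = a + i b the sum of the z^j, j < k, is (z^k - 1) / (z - 1); below, d is
    the square of |z - 1|. *)
Lemma rotation_sum_bound : a != 1 -> exists2 B : R, 0 <= B & forall k,
  `|\sum_(j < k) (rotation j).1| <= B /\ `|\sum_(j < k) (rotation j).2| <= B.
Proof.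
move=> a1; have a_lt : 0 < 1 - a.
  have h : a ^+ 2 <= 1 by rewrite -ab1 lerDl sqr_ge0.
  rewrite subr_gt0 lt_neqAle a1; have : `|a| <= 1.
    by rewrite -(@expr_le1 _ 2)// real_normK ?num_real.
  exact/le_trans/ler_norm.
pose d := 2 * (1 - a); have d0 : 0 < d by rewrite mulr_gt0.
exists (5 / d); first by rewrite divr_ge0// ltW.
move=> k; pose c := (rotation k).1; pose s := (rotation k).2.
have [c1 s1] := rotation_bound k.
set X := \sum_(j < k) _; set Y := \sum_(j < k) _.
have [e1 e2] : a * X - b * Y = X + c - 1 /\ b * X + a * Y = Y + s.
  rewrite /X /Y /c /s; elim: k {c s c1 s1 X Y} => [|k [IH1 IH2]].
    by rewrite !big_ord0 /=; split; ring.
  rewrite !big_ord_recr /=; split.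
    rewrite mulrDr mulrDr; lra.
  rewrite mulrDr mulrDr; lra.
have b_le : `|b| <= 1.
  by rewrite -(@expr_le1 _ 2)// real_normK ?num_real// -ab1 lerDr sqr_ge0.
have a_ge : -1 <= a.
  have : `|a| <= 1.
    by rewrite -(@expr_le1 _ 2)// real_normK ?num_real// -ab1 lerDl sqr_ge0.
  by rewrite ler_norml => /andP[].
have dE : d = (1 - a) ^+ 2 + b ^+ 2.
  have -> : (1 - a) ^+ 2 + b ^+ 2 = 1 - 2 * a + (a ^+ 2 + b ^+ 2) by ring.
  by rewrite ab1 /d; ring.
have XE : X * d = (1 - a) * (1 - c) + b * s.
  have -> : X * d = (1 - a) * (X - (a * X - b * Y)) + b * ((b * X + a * Y) - Y).
    by rewrite dE; ring.
  by rewrite e1 e2; ring.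
have YE : Y * d = b * (1 - c) - (1 - a) * s.
  have -> : Y * d = b * (X - (a * X - b * Y)) - (1 - a) * ((b * X + a * Y) - Y).
    by rewrite dE; ring.
  by rewrite e1 e2; ring.
have nd : `|d| = d by rewrite ger0_norm// ltW.
have bs : `|b * s| <= 1 by rewrite normrM mulr_ile1.
have c2 : 0 <= 1 - c <= 2 by move: c1; rewrite ler_norml -/c; lra.
have a2 : 0 <= 1 - a <= 2 by lra.
have s1' : -1 <= s <= 1 by move: s1; rewrite ler_norml.
have b1' : -1 <= b <= 1 by move: b_le; rewrite ler_norml.
move: bs; rewrite ler_norml => bs.
split; rewrite ler_pdivlMr// -{1}nd -normrM ?XE ?YE ler_norml.
  by apply/andP; split; nra.
by apply/andP; split; nra.
Qed.

End rotations.
(** * Unimodular eigenvectors *)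

Section unimodular_eigenvector.
Context {R : realType} {E : banachLatticeType R} (T : {linear E -> E}) (C : R).
Context (T0 : positive_op T) (C0 : 0 < C).
Context (TC : forall n x, `|iter n T x| <= C * `|x|).
Context (n : nat) (n0 : (0 < n)%N) (a b : R) (ab1 : a ^+ 2 + b ^+ 2 = 1).
Context (x y : E).
Context (Tx : iter n T x = a *: x - b *: y) (Ty : iter n T y = b *: x + a *: y).

Let v := lat_abs x + lat_abs y.

Lemma eigenvector_iter k :
  iter (n * k) T x = (rotation a b k).1 *: x - (rotation a b k).2 *: y /\
  iter (n * k) T y = (rotation a b k).2 *: x + (rotation a b k).1 *: y.
Proof.
elim: k => [|k [IHx IHy]].
  by rewrite muln0 /= !scale1r !scale0r subr0 add0r.
rewrite mulnS !iterD IHx IHy /=; move: (rotation a b k) => [c s] /=.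
have TZ (r : R) (z : E) : iter n T (r *: z) = r *: iter n T z by exact: linearZ.
have TD (z w : E) : iter n T (z + w) = iter n T z + iter n T w by exact: linearD.
have TN (z : E) : iter n T (- z) = - iter n T z by exact: linearN.
by split; rewrite TD ?TN !TZ Tx Ty; linear_identity.
Qed.

Lemma eigenvector_recurrent : exists k : nat -> nat,
  [/\ forall i, (0 < k i)%N, recurrent T k x & recurrent T k y].
Proof.
have /choice[k kP] : forall i : nat, exists k : nat, [/\ (0 < k)%N,
    `|(rotation a b k).1 - 1| < i.+1%:R^-1 & `|(rotation a b k).2| < i.+1%:R^-1].
  by move=> i; apply: (rotation_recurrence ab1); rewrite invr_gt0.
exists (fun i => (n * k i)%N).
have close (z w : E) (eps : R) : 0 < eps -> exists N : nat, forall i : nat,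
    (N <= i)%N -> `|((rotation a b (k i)).1 - 1) *: z| +
      `|(rotation a b (k i)).2 *: w| < eps.
  move=> eps0; have B0 : 0 < `|z| + `|w| + 1 by rewrite ltr_wpDl ?addr_ge0.
  have [N hN] := inv_succ_small (divr_gt0 eps0 B0).
  exists N => i /hN; rewrite ltr_pdivlMr//; apply: le_lt_trans.
  have [_ /ltW h1 /ltW h2] := kP i; rewrite !normrZ mulrDr mulr1 mulrDr -addrA.
  apply: lerD; first by rewrite ler_wpM2r.
  apply: le_trans (ler_wpM2r (normr_ge0 w) h2) _.
  by rewrite lerDl invr_ge0.
split=> [i||]; first by rewrite muln_gt0 n0; have [] := kP i.
- move=> eps /(close x y)[N hN]; exists N => i /hN; apply: le_lt_trans.
  apply: le_trans (ler_normB _ _); rewrite (eigenvector_iter (k i)).1.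
  suff -> : forall c s : R, c *: x - s *: y - x = (c - 1) *: x - s *: y by [].
  by move=> c s; linear_identity.
- move=> eps /(close y x)[N hN]; exists N => i /hN; apply: le_lt_trans.
  apply: le_trans (ler_normD _ _); rewrite (eigenvector_iter (k i)).2.
  suff -> : forall c s : R, s *: x + c *: y - y = (c - 1) *: y + s *: x by [].
  by move=> c s; linear_identity.
Qed.

Lemma eigenvector_sums_bounded : a != 1 -> exists B : R, forall k,
  `|\sum_(j < k) iter (n * j) T x| <= B /\ `|\sum_(j < k) iter (n * j) T y| <= B.
Proof.
move=> a1; have [B B0 hB] := rotation_sum_bound ab1 a1.
exists (B * `|x| + B * `|y|) => k; have [h1 h2] := hB k.
have bnd (c s : R) (z w : E) : `|c| <= B -> `|s| <= B ->
    `|c *: z + s *: w| <= B * `|z| + B * `|w|.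
  move=> hc hs; apply: le_trans (ler_normD _ _) _; rewrite !normrZ.
  by apply: lerD; exact: ler_wpM2r.
have -> : \sum_(j < k) iter (n * j) T x = (\sum_(j < k) (rotation a b j).1) *: x
    + (- \sum_(j < k) (rotation a b j).2) *: y.
  rewrite -sumrN !scaler_suml -big_split /=; apply: eq_bigr => j _.
  by rewrite (eigenvector_iter j).1 scaleNr.
have -> : \sum_(j < k) iter (n * j) T y = (\sum_(j < k) (rotation a b j).2) *: x
    + (\sum_(j < k) (rotation a b j).1) *: y.
  rewrite !scaler_suml -big_split /=; apply: eq_bigr => j _.
  by rewrite (eigenvector_iter j).2.
by split; apply: bnd => //; rewrite normrN.
Qed.

Lemma abs_combination_le (c s : R) (z w : E) : `|c| <= 1 -> `|s| <= 1 ->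
  lat_abs (c *: z + s *: w) <=E lat_abs z + lat_abs w.
Proof.
have le r u : `|r| <= 1 -> lat_abs (r *: u) <=E lat_abs u.
  move=> r1; rewrite absZ; apply/bl_subr_ge0.
  rewrite -[X in X - _]scale1r -scalerBl; apply: bl_scale0; last exact: abs_ge0.
  by rewrite subr_ge0.
by move=> c1 s1; apply: bl_trans (absD _ _) _; apply: le_bl_add; exact: le.
Qed.

Lemma eigenvector_moduli_le j :
  lat_abs (iter (n * j) T x) + lat_abs (iter (n * j) T y) <=E 2 *: v.
Proof.
have [c1 s1] := rotation_bound ab1 j; have [-> ->] := eigenvector_iter j.
have s1' : `|- (rotation a b j).2| <= 1 by rewrite normrN.
have h1 := abs_combination_le x y c1 s1'; rewrite scaleNr in h1.
have h2 := abs_combination_le x y s1 c1.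
by have h := le_bl_add h1 h2; rewrite /v; by_le h.
Qed.

(** The rotation by mu^j is inverted: x and y are combinations of the images of x
    and y with coefficients of modulus at most 1. *)
Lemma eigenvector_moduli_ge j : v <=E 2 *: iter (n * j) T v.
Proof.
have [c1 s1] := rotation_bound ab1 j; have [Ex Ey] := eigenvector_iter j.
have cs := rotation_norm ab1 j.
move: c1 s1 cs Ex Ey; move: (rotation a b j) => [c s] /= c1 s1 cs Ex Ey.
have s1' : `|- s| <= 1 by rewrite normrN.
have xE : x = c *: iter (n * j) T x + s *: iter (n * j) T y.
  by rewrite -[LHS]scale1r -cs Ex Ey; linear_identity.
have yE : y = - s *: iter (n * j) T x + c *: iter (n * j) T y.
  by rewrite -[LHS]scale1r -cs Ex Ey; linear_identity.
have h1 := abs_combination_le (iter (n * j) T x) (iter (n * j) T y) c1 s1.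
have h2 := abs_combination_le (iter (n * j) T x) (iter (n * j) T y) s1' c1.
rewrite -xE in h1; rewrite -yE in h2.
have h3 := le_bl_add (abs_iter_le T0 (n * j) x) (abs_iter_le T0 (n * j) y).
have h := le_bl_add (le_bl_add h1 h2) (le_bl_add h3 h3).
have -> : iter (n * j) T v = iter (n * j) T (lat_abs x) + iter (n * j) T (lat_abs y).
  exact: linearD.
by rewrite /v; by_le h.
Qed.

Let v_ge0 : 0 <=E v.
Proof. by apply: bl_add_ge0; exact: abs_ge0. Qed.

Lemma iter_le_sum i : (i < n)%N -> iter i T v <=E \sum_(j < n) iter j T v.
Proof.
move=> i_n; rewrite (bigD1 (Ordinal i_n)) //= -[X in X <=E _]addr0.
apply: le_bl_add; first exact: bl_lexx.
elim/big_ind : _ => [|z w|j _]; [exact: bl_lexx|exact: bl_add_ge0|].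
exact: iter_positive.
Qed.

Let e1 := 2 *: \sum_(i < n) iter i T v.

(** Some k + i with i < n is a multiple of n. *)
Lemma orbit_bounded_below k : v <=E iter k T e1.
Proof.
pose i := ((n - k %% n) %% n)%N; have i_n : (i < n)%N by rewrite ltn_mod.
have /dvdnP[j kj] : (n %| k + i)%N.
  by rewrite /dvdn /i modnDmr -modnDml subnKC ?modnn// ltnW// ltn_mod.
have h1 := eigenvector_moduli_ge j; rewrite mulnC -kj iterD in h1.
apply: bl_trans h1 _.
have -> : iter k T e1 = 2 *: iter k T (\sum_(i < n) iter i T v) by exact: linearZ.
apply: le_blZ => //; apply: positive_mono; first exact: iter_positive.
exact: iter_le_sum.
Qed.

Lemma orbit_bounded_above (M : set E) k :
  homomorphic_sublattice T M -> M x -> M y -> iter k T v <=E e1.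
Proof.
move=> MT Mx My; rewrite (divn_eq k n) addnC iterD mulnC.
have vE : iter (n * (k %/ n)) T v <=E 2 *: v.
  have -> : iter (n * (k %/ n)) T v = iter (n * (k %/ n)) T (lat_abs x)
      + iter (n * (k %/ n)) T (lat_abs y) by exact: linearD.
  rewrite !(iter_abs MT)//; exact: eigenvector_moduli_le.
apply: (@bl_trans _ _ (iter (k %% n) T (2 *: v))).
  by apply: positive_mono vE; exact: iter_positive.
have -> : iter (k %% n) T (2 *: v) = 2 *: iter (k %% n) T v by exact: linearZ.
apply: le_blZ => //; apply: iter_le_sum.
by rewrite ltn_mod.
Qed.

(** An eigenvector provides the two objects that the rest of the proof compares
    all other eigenvectors with: a strictly positive invariant functional and a
    positive fixed vector. *)
Lemma fixed_vector_and_functional : order_continuous_norm E -> irreducible_op T ->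
  x != 0 \/ y != 0 ->
  exists (f : {scalar E}) (e : E),
    [/\ forall z, 0 <=E z -> 0 <= f z, forall z, `|f z| <= C * `|z|,
        forall z, f (T z) = f z & forall z, 0 <=E z -> f z = 0 -> z = 0] /\
    [/\ 0 <=E e, e != 0 & T e = e].
Proof.
move=> ocn Tirr xy; have vn0 : v != 0.
  apply/eqP => v0.
  have x0 : lat_abs x = 0.
    apply: bl_anti (abs_ge0 _); have h := abs_ge0 y.
    by rewrite -v0 /v; by_le h.
  have y0 : lat_abs y = 0 by move: v0; rewrite /v x0 add0r.
  by case: xy => /eqP; apply; exact: abs_eq0.
have [f [f_ge0 f_bnd f_inv fe1]] :=
  invariant_functional T0 C0 TC v_ge0 vn0 orbit_bounded_below.
have f_strict : forall z, 0 <=E z -> f z = 0 -> z = 0.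
  apply: (invariant_functional_strict T0 Tirr f_ge0 f_bnd f_inv).
  by exists e1; rewrite gt_eqF.
have [k [k0 kx ky]] := eigenvector_recurrent.
have MT := recurrent_homomorphic_sublattice T0 C0 TC f_ge0 f_bnd f_inv f_strict k0.
have Mv : recurrent T k v by apply: (hsubD MT); apply: (hsub_abs MT).
have [e Te ve] := fixed_vector_above MT ocn C0 TC f_inv f_strict Mv
  (fun k => orbit_bounded_above k MT kx ky).
exists f, e; split=> //; split=> //; first exact: bl_trans v_ge0 ve.
apply/eqP => e0; case/eqP : vn0; apply: bl_anti (v_ge0).
by rewrite -e0.
Qed.

End unimodular_eigenvector.

Section complex_eigenvalue.
Context {R : realType} {E : banachLatticeType R} (T : {linear E -> E}).

Lemma complexify_iter n (z : complexification E) :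
  iter n (complexify_op T) z = (iter n T z.1, iter n T z.2).
Proof. by elim: n => [|n IH] /=; [case: z|rewrite IH]. Qed.

Lemma complex_eigenvector n (mu : R[i]) :
  point_spectrum (iter n (complexify_op T)) mu -> exists x y : E,
    [/\ x != 0 \/ y != 0,
        iter n T x = complex.Re mu *: x - complex.Im mu *: y &
        iter n T y = complex.Im mu *: x + complex.Re mu *: y].
Proof.
move=> [[x y] xy]; rewrite complexify_iter => -[Tx Ty]; exists x, y; split.
- have [x0|] := eqVneq x 0; last by left.
  by right; apply: contra xy => /eqP y0; rewrite x0 y0.
- exact: Tx.
- by rewrite addrC; exact: Ty.
Qed.

Lemma unimodular_complex (mu : R[i]) : `|mu| = 1 ->
  complex.Re mu ^+ 2 + complex.Im mu ^+ 2 = 1.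
Proof.
move=> /(congr1 (@complex.Re R)); rewrite normc_def /= => h.
by rewrite -[LHS]sqr_sqrtr ?h ?expr1n// addr_ge0 ?sqr_ge0.
Qed.

End complex_eigenvalue.

Section uniform_power.
Context {R : realType} {E : banachLatticeType R} (T : {linear E -> E}) (C : R).
Context (ocn : order_continuous_norm E).
Context (T0 : positive_op T) (C0 : 0 < C).
Context (TC : forall n x, `|iter n T x| <= C * `|x|).
Context (Tirr : irreducible_op T).
Context (f : {scalar E}).
Context (f_ge0 : forall x, 0 <=E x -> 0 <= f x).
Context (f_bnd : forall x, `|f x| <= C * `|x|).
Context (f_inv : forall x, f (T x) = f x).
Context (f_strict : forall x, 0 <=E x -> f x = 0 -> x = 0).
Context (e : E) (e0 : 0 <=E e) (Te : T e = e).

(** Atoms have norm at least eps, hence mass under f at least del and period at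
    most N, in all the sublattices that arise from eigenvectors. So all periods
    divide N`!. *)
Lemma uniform_period (eps : R) : 0 < eps ->
  (forall M, homomorphic_sublattice T M -> ~ fine_sum M eps e) ->
  exists2 n : nat, (0 < n)%N & forall (a b : R) (x y : E),
    a ^+ 2 + b ^+ 2 = 1 -> x != 0 \/ y != 0 ->
    iter n T x = a *: x - b *: y -> iter n T y = b *: x + a *: y -> a = 1.
Proof.
move=> eps0 not_fine.
have [del del0 hdel] :=
  strictly_positive_absolute_continuity ocn f_ge0 f_bnd f_strict e0 eps0.
pose N := Num.bound (f e / del).
have hN : f e < N%:R * del.
  by rewrite -ltr_pdivrMr//; apply: archi_boundP; apply: divr_ge0 (ltW del0); exact: f_ge0.
exists N`!; first exact: fact_gt0.
move=> a b x y ab1 xy Tx Ty; apply/eqP/negPn/negP => a1.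
have [k [k0 kx ky]] := eigenvector_recurrent (fact_gt0 N) ab1 Tx Ty.
have MT := recurrent_homomorphic_sublattice T0 C0 TC f_ge0 f_bnd f_inv f_strict k0.
have Me : recurrent T k e.
  move=> d d0; exists 0%N => i _.
  suff -> : iter (k i) T e = e by rewrite subrr normr0.
  by elim: (k i) => [//|j IH] /=; rewrite IH.
have [p patom peps] := atom_exists ocn e0 MT Me eps0 (not_fine _ MT).
have [Mp pc _ _] := patom.
have fp : del <= f p.
  rewrite leNgt; apply/negP => lt.
  have := hdel p (component_ge0 pc) (component_le pc) lt.
  by rewrite ltNge peps.
have [|d [d0 dN dp]] := atom_returns T0 f_ge0 f_inv f_strict e0 Te MT Me (N := N) patom.
  by apply: lt_le_trans hN _; exact: ler_wpM2l.
have np : iter N`! T p = p by apply: iter_mul_fix dp _; rewrite dvdn_fact ?d0.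
have [B hB] := eigenvector_sums_bounded ab1 Tx Ty a1.
have x0 : x = 0.
  by apply: (bounded_sums_eq0 ocn T0 C0 TC Tirr f_ge0 f_bnd f_inv f_strict MT Me
    (fact_gt0 N) patom np kx) => j; exact: (hB j).1.
have y0 : y = 0.
  by apply: (bounded_sums_eq0 ocn T0 C0 TC Tirr f_ge0 f_bnd f_inv f_strict MT Me
    (fact_gt0 N) patom np ky) => j; exact: (hB j).2.
by case: xy; rewrite ?x0 ?y0 eqxx.
Qed.

End uniform_power.

Theorem theorem3p4 (R : realType) (E : banachLatticeType R)
    (T : {linear E -> E}) :
  order_continuous_norm E ->
  positive_op T -> irreducible_op T -> power_bounded T ->
  (exists (m : nat) (K : {linear E -> E}),
     [/\ (0 < m)%N, op_ge (iter m T) K, positive_op K, exists x, K x != 0 &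
         compact_op K \/ kernel_op K]) ->
  exists2 n : nat, (0 < n)%N &
    point_spectrum (iter n (complexify_op T)) `&` [set z : R[i] | `|z| = 1]
      `<=` [set 1].
Proof.
move=> ocn T0 Tirr Tpb [m [K [_ KT K0 Kn0 Kclass]]].
have [C C0 TC] := power_bounded_bound Tpb.
have [[n1 [n1_gt0 [mu1 [mu1_eig mu1_norm]]]]|none] := pselect (exists n : nat,
    (0 < n)%N /\ exists mu : R[i],
      point_spectrum (iter n (complexify_op T)) mu /\ `|mu| = 1); last first.
  exists 1%N => // mu [mu_eig mu_norm]; exfalso; apply: none; exists 1%N; split=> //.
  by exists mu.
have [x1 [y1 [xy1 Tx1 Ty1]]] := complex_eigenvector mu1_eig.
have [f [e [[f_ge0 f_bnd f_inv f_strict] [e0 en0 Te]]]] :=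
  fixed_vector_and_functional T0 C0 TC n1_gt0 (unimodular_complex mu1_norm)
    Tx1 Ty1 ocn Tirr xy1.
have at_e (L : {linear E -> E}) : positive_op L -> op_ge (iter m T) L ->
    (exists x, L x != 0) -> L e != 0.
  move=> L0 LT [x Lx]; apply: contra Lx => /eqP Le.
  by rewrite (positive_dominated_eq0 T0 C0 TC Tirr e0 en0 Te L0 LT Le).
have [eps eps0 not_fine] : exists2 eps : R, 0 < eps &
    forall M, homomorphic_sublattice T M -> ~ fine_sum M eps e.
  case: Kclass => [Kcpt|Kker].
    exact: (not_fine_compact C0 TC K0 KT (at_e K K0 KT Kn0) Kcpt).
  have [L [w [L0 /op_geP LK Ln0 Lw]]] := kernel_op_minorant ocn K0 Kker Kn0.
  have LT : op_ge (iter m T) L.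
    apply/op_geP => x x0; apply: bl_trans (LK x x0) _.
    by move/op_geP : KT; apply.
  exact: (not_fine_dominated e0 L0 LT (at_e L L0 LT Ln0) Lw).
have [n n_gt0 hn] := uniform_period ocn T0 C0 TC Tirr f_ge0 f_bnd f_inv f_strict
  e0 Te eps0 not_fine.
exists n => // mu [mu_eig mu_norm]; have ab1 := unimodular_complex mu_norm.
have [x [y [xy Tx Ty]]] := complex_eigenvector mu_eig.
have re1 := hn _ _ x y ab1 xy Tx Ty.
have im0 : complex.Im mu = 0.
  apply/eqP; rewrite -sqrf_eq0; move/eqP : ab1.
  by rewrite re1 expr1n -subr_eq0 addrAC subrr add0r.
by apply/eqP; rewrite eq_complex /= re1 im0 !eqxx.
Qed.
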